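(* Let the setting be that of the context, and let $\eta_{\rm feat},\eta_{\rm AS,feat},\eta_{\rm LS},\eta_{\rm AS}\in(0,1)$ have sum less than one. Assume: (H1) (decomposition) $u(x)=u_{\rm coord}(x)+h(W^\top x)+u_\perp(x)$, where $u_{\rm coord}=\sum_{S\in\mathcal A^\star}u_{S,{\rm coord}}$ with $u_{S,{\rm coord}}$ depending only on $x_S$, $h:\mathbb R^{r_{\rm AS}}\to\mathbb R$, and $\|u_\perp\|_{L^2(\Omega)}+C_{\rm ell}^{\rm bd}\|u_\perp\|_{\mathcal R}\le\tau_{\rm mix}\|u\|_{L^2(\Omega)}$ with $\tau_{\rm mix}\ge0$. (H2) (elliptic stability) $\|e\|_{L^2(\Omega)}\le C_{\rm ell}^{\rm bd}\|e\|_{\mathcal R}$ for all $e\in H^1(\Omega)$ with $\operatorname{Tr}e\in\mathcal Y_\partial$. (H3) (rotation) With $\theta_{\rm AS}:=\|\sin\Theta(\widehat W_{r_{\rm AS}},W)\|_{\rm op}$, an orthogonal $Q\in\mathbb R^{r_{\rm AS}\times r_{\rm AS}}$ chosen such that $\|W-\widehat W_{r_{\rm AS}}Q^\top\|_{\rm op}\le\sqrt2\,\theta_{\rm AS}$, and $h_Q(z):=h(Qz)$, $$\|h(W^\top x)-h_Q(\widehat W_{r_{\rm AS}}^\top x)\|_{\mathcal R}\le C_{\rm ridge}L_hX_\Omega\theta_{\rm AS}.$$ (H4) (coordinate features) For each nonempty $S\in\mathcal A^\star$ with $|S|=k$ and each $\eta\in(0,1)$, with probability at least $1-\eta$ over the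 features, $\inf_{v_S\in\mathcal V_{S,M_k}}\|u_{S,{\rm coord}}-v_S\|_{H^2(\Omega_S)}\le e^{\rm rf,c}_{S,M_k}(R_{\rm rf},\eta)$. (H5) (global features) With probability at least $1-\eta_{\rm AS,feat}$, $\inf_{v_{\rm AS}\in\mathcal V_{\rm AS}}\|h_Q(\widehat W_{r_{\rm AS}}^\top x)-v_{\rm AS}\|_{\mathcal R}\le\mathcal E_{\rm AS}$, where $\mathcal E_{\rm AS}=a_{\rm AS}\{E^{\rm AS}_{\rm trunc}(R_{\rm rf};h)+M_{\rm glob}^{-s_{\rm rf}/(2r_{\rm AS})}\ell_{\rm AS}(\eta_{\rm AS,feat})\}$. (H6) (augmented block stability) With $v_\emptyset=u_{\emptyset,{\rm coord}}$, $v_S\in\mathcal V_{S,M_{|S|}}$ realizing (H4) for nonempty $S$, and $z_{S,{\rm coord}}=u_{S,{\rm coord}}-v_S$, there is $\Gamma_{\rm aug}\ge1$ with $$\Bigl\|\sum_{S\in\mathcal A^\star}z_{S,{\rm coord}}\Bigr\|_{\mathcal R}\le C_{\rm op}\Gamma_{\rm aug}^{1/2}\Bigl(\sum_{S\in\mathcal A^\star}\|z_{S,{\rm coord}}\|_{H^2(\Omega_S)}^2\Bigr)^{1/2}.$$ (H7) (least-squares stability of the joint solve) For the comparison function $u^\dagger=\sum_{S\in\mathcal A^\star}v_S+v_{\rm AS}\in\mathcal V_{\mathcal A^\star}+\mathcal V_{\rm AS}$, with $v_{\rm AS}$ realizing (H5) and coefficient vector of Euclidean norm at most $B_{\rm coef}^{\rm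 aug}$, with probability at least $1-\eta_{\rm LS}$ over the collocation samples $$\|\widehat u_{\rm HA}-u^\dagger\|_{\mathcal R}\le C_{\rm ls}\bigl[\|u^\dagger-u\|_{\mathcal R}+C_{\rm samp}\chi_N^{\rm aug}+C_{\rm reg}\lambda_{\rm reg}^{1/2}B_{\rm coef}^{\rm aug}\bigr].$$ (H8) (subspace event) $\mathbf C_u$ has eigengap $\Delta=\nu_{r_{\rm AS}}-\nu_{r_{\rm AS}+1}>0$, and the subspace-identification event $\|\widehat{\mathbf C}-\widetilde{\mathbf C}\|_{\rm op}+\|\widetilde{\mathbf C}-\mathbf C_u\|_{\rm op}\le\Delta/2$ has failure probability at most $\eta_{\rm AS}$. Set $C_{\rm mix}:=\max\{1,C_{\rm ls}\}$. Then, on the feature, least-squares and subspace-identification events, hence with probability at least $1-\eta_{\rm feat}-\eta_{\rm AS,feat}-\eta_{\rm LS}-\eta_{\rm AS}$, $$\begin{aligned}\|u-\widehat u_{\rm HA}\|_{L^2(\Omega)}&\le C_{\rm mix}\tau_{\rm mix}\|u\|_{L^2(\Omega)}+C_{\rm ell}^{\rm bd}(1+C_{\rm ls})\Bigl[C_{\rm op}\Gamma_{\rm aug}^{1/2}\Bigl(\sum_{k=1}^{K^\star}\mathcal E_k^{\rm c}(R_{\rm rf},M_k,\eta_{\rm feat})^2\Bigr)^{1/2}\\&\qquad+C_{\rm ridge}L_hX_\Omega\theta_{\rm AS}+\mathcal E_{\rm AS}+C_{\rm samp}\chi_N^{\rm aug}+C_{\rm reg}\lambda_{\rm reg}^{1/2}B_{\rm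 coef}^{\rm aug}\Bigr],\end{aligned}$$ where $$\theta_{\rm AS}\le\frac2\Delta\Bigl[\|\widehat{\mathbf C}-\widetilde{\mathbf C}\|_{\rm op}+\bigl(\|\nabla u\|_{L^2_\mu}+\|\nabla\widetilde u\|_{L^2_\mu}\bigr)\|\nabla(u-\widetilde u)\|_{L^2_\mu}\Bigr].$$
   Context: Domain, PDE, norm. $\Omega=\prod_{i=1}^d\Omega_i\subset\mathbb R^d$ is a bounded product domain with product probability reference measure $\mu$ (normalized Lebesgue on cubes); $x_S$, $\Omega_S$ are restrictions to coordinates in $S\subseteq\{1,\dots,d\}$. $Lv=-\sum a_{ij}\partial_{ij}v+b\cdot\nabla v+\kappa v$ is uniformly elliptic with sufficiently regular coefficients; $u$ solves $Lu=f$ in $\Omega$ with Dirichlet data $g$ (handled by a fixed boundary lift). $\operatorname{Tr}$ is the trace, $\mathcal Y_\partial$ a trace space on $\partial\Omega$ (e.g. $H^{1/2}(\partial\Omega)$), $\omega_{\rm th}>0$, and $\|v\|_{\mathcal R}:=\|Lv\|_{H^{-1}(\Omega)}+\omega_{\rm th}\|\operatorname{Tr}v\|_{\mathcal Y_\partial}$. Coordinate trial space. $\mathcal A^\star$ is a fixed family of subsets of $\{1,\dots,d\}$ containing $\emptyset$ and all singletons, $K^\star=\max_{S\in\mathcal A^\star}|S|$, $n_k^{\rm blk}=|\{S\in\mathcal A^\star:|S|=k\}|$. For $|S|=k\ge1$, $\mathcal V_{S,M_k}$ is the span of $M_k$ random features $\sigma(\omega_{S,m}\cdot x_S+b_{S,m})$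 ($\sigma\in C^2(\mathbb R)$; random frozen parameters; frequency radius $R_{\rm rf}>0$); $\mathcal V_{\emptyset,1}$ is the constants. $\mathcal V_{\mathcal A^\star}=\sum_{S\in\mathcal A^\star}\mathcal V_{S,M_{|S|}}$. Active subspace. $\mathbf C_u=\mathbb E_\mu[\nabla u\nabla u^\top]$ has eigenvalues $\nu_1\ge\dots\ge\nu_d\ge0$; $1\le r_{\rm AS}<d$; $\widetilde u$ is a fitted predictor in $\mathcal V_{\mathcal A^\star}$; $\widetilde{\mathbf C}=\mathbb E_\mu[\nabla\widetilde u\nabla\widetilde u^\top]$; $\widehat{\mathbf C}=\frac1{N_{\rm AS}}\sum_n\nabla\widetilde u(x_n)\nabla\widetilde u(x_n)^\top$ with $x_n$ i.i.d. from $\mu$ conditionally on $\widetilde u$, independent of the other samples. $W,\widehat W_{r_{\rm AS}}\in\mathbb R^{d\times r_{\rm AS}}$ are orthonormal bases of the leading $r_{\rm AS}$-dimensional eigenspaces of $\mathbf C_u$ and $\widehat{\mathbf C}$; $\Theta$ denotes principal angles, and $\|\nabla v\|_{L^2_\mu}=(\int_\Omega\|\nabla v\|_2^2d\mu)^{1/2}$. $\mathcal V_{\rm AS}$ is the span of $M_{\rm glob}$ random features $\sigma((\widehat W_{r_{\rm AS}}\xi_m)\cdot x+b_{{\rm glob},m})$, $\xi_m\in\mathbb R^{r_{\rm AS}}$ and $b_{{\rm glob},m}\in\mathbb R$ random. Constants. $X_\Omega=(\mathbb E_{X\sim\mu}\|X\|_2^2)^{1/2}$; $L_h$ bounds the derivatives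 of $h$ entering $\mathcal R$; $C_{\rm ridge},C_{\rm ell}^{\rm bd},C_{\rm op},C_{\rm ls},C_{\rm samp},C_{\rm reg}$ are positive constants; $a_{\rm AS}>0$ is an amplitude, $E^{\rm AS}_{\rm trunc}\ge0$ a frequency-window bias, $\ell_{\rm AS}>0$ a logarithmic factor, $s_{\rm rf}>0$; $\chi_N^{\rm aug}\ge0$ is the sampled-least-squares fluctuation of the augmented space (the analogue of $(N_{\rm int}^{-1/2}+N_{\rm bc}^{-1/2})\sqrt{\log(1/\eta_{\rm LS})}$). The numbers $e^{\rm rf,c}_{S,M_k}(R_{\rm rf},\eta)\ge0$ are given and, for $n_k^{\rm blk}>0$, $$\mathcal E_k^{\rm c}(R_{\rm rf},M_k,\eta)^2:=\sum_{S\in\mathcal A^\star,|S|=k}e^{\rm rf,c}_{S,M_k}\Bigl(R_{\rm rf},\frac{\eta}{K^\star n_k^{\rm blk}}\Bigr)^2,$$ with value $0$ when $n_k^{\rm blk}=0$. Fitted function. $\widehat u_{\rm HA}\in\mathcal V_{\mathcal A^\star}+\mathcal V_{\rm AS}$ is the joint Tikhonov-regularized collocation least-squares solution: its coefficient vector $\bm c$ (over all coordinate and global features) minimizes $\frac1{N_{\rm int}}\sum_n|Lv_{\bm c}(x^{\rm int}_n)-f(x^{\rm int}_n)|^2+\frac{\omega_{\rm bc}^2}{N_{\rm bc}}\sum_n|v_{\bm c}(x^{\rm bc}_n)-g(x^{\rm bc}_n)|^2+\lambda_{\rm reg}\|\bm c\|_2^2$ at random interior/boundary points, $\omega_{\rm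 bc}>0$, $\lambda_{\rm reg}\ge0$. *)

(* Defs.v *)
From HB Require Import structures.
From mathcomp Require Import all_boot all_order all_algebra.
From mathcomp Require Import all_classical all_reals all_analysis.
Set Implicit Arguments. Unset Strict Implicit. Unset Printing Implicit Defensive.
Import Order.TTheory GRing.Theory Num.Theory.
Import numFieldNormedType.Exports.
Local Open Scope classical_set_scope.
Local Open Scope ring_scope.

(* R^n is 'rV[R]_n with the sigma-algebra generated by the coordinates, the
   analogue of the library's sigma-algebra on tuples. *)

Section measurable_rV.
Context (R : realType) (n : nat).
Definition rV_coord (i : 'I_n) (x : 'rV[R]_n) : R := x 0 i.
Let m0 : g_sigma_preimage rV_coord set0. Proof. exact: sigma_algebra0. Qed.
Let mC A : g_sigma_preimage rV_coord A -> g_sigma_preimage rV_coord (~` A).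
Proof. exact: sigma_algebraC. Qed.
Let mU (F : (set 'rV[R]_n)^nat) : (forall i, g_sigma_preimage rV_coord (F i)) ->
  g_sigma_preimage rV_coord (\bigcup_i (F i)).
Proof. exact: sigma_algebra_bigcup. Qed.
HB.instance Definition _ :=
  @isMeasurable.Build (measure_tuple_display default_measure_display) 'rV[R]_n
    (g_sigma_preimage rV_coord) m0 mC mU.
End measurable_rV.

Lemma measurable_rV_coord (R : realType) n (i : 'I_n) :
  measurable_fun [set: 'rV[R]_n] (fun x : 'rV[R]_n => x 0 i).
Proof.
move=> _ Y mY; rewrite setTI; apply: sub_sigma_algebra => /=.
rewrite -bigcup_seq/=; exists i => /=; first by rewrite mem_index_enum.
by exists Y => //; rewrite setTI.
Qed.

Lemma measurable_fun_rVP d (T : measurableType d) (R : realType) n (f : T -> 'rV[R]_n) :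
  measurable_fun [set: T] f <->
  forall i, measurable_fun [set: T] (fun t => f t 0 i).
Proof.
split=> [mf i|mf].
  exact: (measurableT_comp (@measurable_rV_coord R n i)).
move=> _ A mA; rewrite setTI.
have H : g_sigma_preimage (fun i => @rV_coord R n i \o f) `<=` measurable.
  apply: smallest_sub; first exact: sigma_algebra_measurable.
  case: n => [|n] in f mf A mA *; first by rewrite big_ord0.
  rewrite -bigcup_mkord_ord; apply: bigcup_sub => i Ii.
  by move=> B [C mC <-]; exact: mf.
apply: H; rewrite g_sigma_preimage_comp.
by exists A => //; rewrite setTI.
Qed.

Section prodm.
Context (R : realType).
Implicit Type n : nat.

Definition rV_cons n (p : R * 'rV[R]_n) : 'rV[R]_n.+1 :=
  \row_i if unlift ord0 i is Some j then p.2 0 j else p.1.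

Lemma measurable_rV_cons n : measurable_fun [set: R * 'rV[R]_n] (@rV_cons n).
Proof.
apply/measurable_fun_rVP => i; case: (unliftP ord0 i) => [j|] ->.
  rewrite (_ : (fun _ => _) = (fun x : 'rV[R]_n => x 0 j) \o snd).
    exact: measurableT_comp (@measurable_rV_coord R n j) measurable_snd.
  by apply/funext => t; rewrite mxE liftK.
rewrite (_ : (fun _ => _) = fst); first exact: measurable_fst.
by apply/funext => t; rewrite mxE unlift_none.
Qed.

Section step.
Variables (n : nat) (m : {sigma_finite_measure set (measurableTypeR R) -> \bar R})
  (mu : {sigma_finite_measure set 'rV[R]_n -> \bar R}).

Definition prodm_step : set 'rV[R]_n.+1 -> \bar R :=
  pushforward (m \x mu)%E (@rV_cons n).


Let step0 : prodm_step set0 = 0%E.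
Proof. by rewrite /prodm_step /pushforward preimage_set0 measure0. Qed.

Let step_ge0 A : (0 <= prodm_step A)%E.
Proof. by rewrite /prodm_step /pushforward; exact: measure_ge0. Qed.

Let step_sigma_additive : semi_sigma_additive prodm_step.
Proof.
move=> F mF tF mUF; rewrite /prodm_step /pushforward preimage_bigcup.
apply: measure_semi_sigma_additive.
- by move=> k; rewrite -[X in measurable X]setTI; exact: measurable_rV_cons.
- apply/trivIsetP => /= i j _ _ ij; rewrite -preimage_setI.
  by move/trivIsetP : tF => /(_ _ _ _ _ ij) ->//; rewrite preimage_set0.
- by rewrite -preimage_bigcup -[X in measurable X]setTI; exact: measurable_rV_cons.
Qed.

HB.instance Definition _ := isMeasure.Build _ _ _
  prodm_step step0 step_ge0 step_sigma_additive.

Let step_sigma_finite : sigma_finite setT prodm_step.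
Proof.
have [F FT Foo] : sigma_finite setT (m \x mu)%E.
  have /sigma_finiteP[F [TF ndF Foo]] := sigma_finiteT m.
  have /sigma_finiteP[G [TG ndG Goo]] := sigma_finiteT mu.
  exists (fun k => F k `*` G k).
    rewrite -setXTT TF TG predeqE => -[x y]; split.
      move=> [/= [k _ Fkx] [l _ Gly]]; exists (maxn k l) => //; split.
      - by move: x Fkx; exact/subsetPset/ndF/leq_maxl.
      - by move: y Gly; exact/subsetPset/ndG/leq_maxr.
    by move=> [k _ []/= ? ?]; split; exists k.
  move=> k; have [? ?] := Foo k; have [? ?] := Goo k.
  split; first exact: measurableX.
  by rewrite product_measure1E// lte_mul_pinfty// ge0_fin_numE.
pose g (x : 'rV[R]_n.+1) : R * 'rV[R]_n :=
  (x 0 ord0, \row_j x 0 (lift ord0 j)).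
have Kg : cancel (@rV_cons n) g.
  move=> [a y]; rewrite /g mxE unlift_none; congr pair.
  by apply/rowP => j; rewrite !mxE liftK.
have mg : measurable_fun setT g.
  apply/prod_measurable_funP; split; first exact: measurable_rV_coord.
  apply/measurable_fun_rVP => i /=.
  rewrite (_ : (fun _ => _) = (fun x : 'rV[R]_n.+1 => x 0 (lift ord0 i))).
    exact: measurable_rV_coord.
  by apply/funext => x /=; rewrite mxE.
exists (fun k => g @^-1` F k).
  by rewrite -preimage_bigcup -FT preimage_setT.
move=> k; have [mFk Fk] := Foo k; split.
  by rewrite -[X in measurable X]setTI; exact: mg.
rewrite /prodm_step /pushforward -comp_preimage.
by rewrite (_ : g \o @rV_cons n = id)// funeqE => p /=; exact: Kg.
Qed.

HB.instance Definition _ := Measure_isSigmaFinite.Build _ _ _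
  prodm_step step_sigma_finite.

End step.

Fixpoint prod_measure n :
    ('I_n -> {sigma_finite_measure set (measurableTypeR R) -> \bar R}) ->
    {sigma_finite_measure set 'rV[R]_n -> \bar R} :=
  if n is n'.+1 then fun m =>
    prodm_step (m ord0) (prod_measure (fun i => m (lift ord0 i)))
  else fun=> \d_(0 : 'rV[R]_0).

Lemma prod_measureE n
    (m : 'I_n -> {sigma_finite_measure set (measurableTypeR R) -> \bar R})
    (B : 'I_n -> set (measurableTypeR R)) : (forall i, measurable (B i)) ->
  prod_measure m [set x | forall i, B i (x 0 i)] =
  (\big[*%E/1%E]_i m i (B i))%E.
Proof.
elim: n m B => [|n IHn] m B mB /=.
  by rewrite big_ord0 diracE mem_set// => -[].
have mC : measurable (\bigcap_(i in [set: 'I_n])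
    ((fun x : 'rV[R]_n => x 0 i) @^-1` B (lift ord0 i))).
  apply: fin_bigcap_measurable => [|i _]; first exact: finite_finset.
  by rewrite -[X in measurable X]setTI; apply: measurable_rV_coord => //; exact: mB.
have CE : \bigcap_(i in [set: 'I_n])
    ((fun x : 'rV[R]_n => x 0 i) @^-1` B (lift ord0 i)) =
    [set x | forall i, B (lift ord0 i) (x 0 i)].
  by apply/seteqP; split => x /= Bx i; [|move=> _]; exact: Bx.
rewrite CE in mC.
rewrite big_ord_recl -IHn // -product_measure1E //.
rewrite /prodm_step /pushforward; congr (_ _).
apply/seteqP; split => -[a y] /=.
  move=> H; split=> [|i]; first by have := H ord0; rewrite mxE unlift_none.
  by have := H (lift ord0 i); rewrite mxE liftK.
move=> [Ba By] i; case: (unliftP ord0 i) => [j|] ->.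
  by rewrite mxE liftK; exact: By.
by rewrite mxE unlift_none.
Qed.

End prodm.

Section setting.
Context (R : realType).

Definition lebesgue n : {sigma_finite_measure set 'rV[R]_n -> \bar R} :=
  prod_measure (fun=> lebesgue_measure).

Definition product_prob n (m : 'I_n -> probability (measurableTypeR R) R) :
    {sigma_finite_measure set 'rV[R]_n -> \bar R} :=
  prod_measure (fun i => m i).

Definition dotp n (x y : 'rV[R]_n) : R := \sum_i x 0 i * y 0 i.

Definition enorm n (x : 'rV[R]_n) : R := Num.sqrt (dotp x x).

(* For a row vector x, x *m A^T is the matrix-vector product A x. *)
Definition opnorm m n (A : 'M[R]_(m, n)) : R :=
  sup [set enorm (x *m A^T) | x in [set x : 'rV[R]_n | enorm x <= 1]].

Definition box n (lo hi : 'rV[R]_n) : set 'rV[R]_n :=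
  [set x | forall i, lo 0 i < x 0 i < hi 0 i].

Definition cbox n (lo hi : 'rV[R]_n) : set 'rV[R]_n :=
  [set x | forall i, lo 0 i <= x 0 i <= hi 0 i].

(* x_S, with the coordinates of S listed in increasing order *)
Definition restr d (S : {set 'I_d}) (x : 'rV[R]_d) : 'rV[R]_#|S| :=
  \row_k x 0 (enum_val k).

Definition partial n (i : 'I_n) (v : 'rV[R]_n -> R) (x : 'rV[R]_n) : R :=
  'D_(delta_mx 0 i : 'rV[R]_n) v x.

Definition grad n (v : 'rV[R]_n -> R) (x : 'rV[R]_n) : 'rV[R]_n :=
  \row_i partial i v x.

Definition iter_partial n (s : seq 'I_n) (v : 'rV[R]_n -> R) :=
  foldr (@partial n) v s.

Definition smooth n (v : 'rV[R]_n -> R) : Prop :=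
  forall s : seq 'I_n, continuous (iter_partial s v) /\
    forall i x, derivable (iter_partial s v) x (delta_mx 0 i : 'rV[R]_n).

Definition test_function n (lo hi : 'rV[R]_n) (phi : 'rV[R]_n -> R) : Prop :=
  smooth phi /\ exists K : set 'rV[R]_n,
    [/\ compact K, K `<=` box lo hi & forall x, ~ K x -> phi x = 0].

Definition C2 (s : R -> R) : Prop :=
  [/\ forall t, derivable s t 1, forall t, derivable (derive1 s) t 1
    & continuous (derive1 (derive1 s))].

Definition L2norm n (mu : {measure set 'rV[R]_n -> \bar R}) (D : set 'rV[R]_n)
    (v : 'rV[R]_n -> R) : \bar R :=
  'N[mu]_2%:E[EFin \o (v \_ D)]%E.

Definition vL2norm n (mu : {measure set 'rV[R]_n -> \bar R}) (D : set 'rV[R]_n)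
    (G : 'rV[R]_n -> 'rV[R]_n) : \bar R :=
  L2norm mu D (fun x => enorm (G x)).

Section sobolev.
Context (n : nat) (lo hi : 'rV[R]_n).
Let Omega := box lo hi.
Let lam := @lebesgue n.

Definition in_L2 (v : 'rV[R]_n -> R) : Prop :=
  measurable_fun Omega v /\ (L2norm lam Omega v < +oo)%E.

Definition weak_partial (i : 'I_n) (v g : 'rV[R]_n -> R) : Prop :=
  forall phi, test_function lo hi phi ->
    \int[lam]_(x in Omega) (v x * partial i phi x) =
    - \int[lam]_(x in Omega) (g x * phi x).

Definition weak_grad (v : 'rV[R]_n -> R) (G : 'rV[R]_n -> 'rV[R]_n) : Prop :=
  in_L2 v /\ forall i, in_L2 (fun x => G x 0 i) /\
                      weak_partial i v (fun x => G x 0 i).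

Definition weak_hess (G : 'rV[R]_n -> 'rV[R]_n) (H : 'rV[R]_n -> 'M[R]_n) :=
  forall i j, in_L2 (fun x => H x i j) /\
              weak_partial j (fun x => G x 0 i) (fun x => H x i j).

Definition in_H1 (v : 'rV[R]_n -> R) : Prop := exists G, weak_grad v G.

Definition H1norm (v : 'rV[R]_n -> R) (G : 'rV[R]_n -> 'rV[R]_n) : \bar R :=
  ((L2norm lam Omega v ^+ 2 +
    \sum_i L2norm lam Omega (fun x => G x 0%R i) ^+ 2) `^ 2^-1)%E.

(* Weak derivatives are unique almost everywhere, so the infimum ranges over
   at most one value; it is +oo when v is not in H^2. *)
Definition H2norm (v : 'rV[R]_n -> R) : \bar R :=
  ereal_inf [set t | exists G H, [/\ weak_grad v G, weak_hess G H &
    t = ((L2norm lam Omega v ^+ 2 +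
          \sum_i L2norm lam Omega (fun x => G x 0%R i) ^+ 2 +
          \sum_(i < n) \sum_(j < n | (i <= j)%N)
             L2norm lam Omega (fun x => H x i j) ^+ 2) `^ 2^-1)%E]].

Record diffop := DiffOp {
  op_a : 'rV[R]_n -> 'M[R]_n;
  op_b : 'rV[R]_n -> 'rV[R]_n;
  op_kappa : 'rV[R]_n -> R }.

Definition bounded_measurable (v : 'rV[R]_n -> R) : Prop :=
  measurable_fun Omega v /\ exists C, forall x, Omega x -> `|v x| <= C.

Definition regular_coefficients (L : diffop) : Prop :=
  [/\ forall i j, bounded_measurable (fun x => op_a L x i j),
      forall i j k,
        (forall x, Omega x ->
           derivable (fun y => op_a L y i j) x (delta_mx 0 k : 'rV[R]_n)) /\
        bounded_measurable (partial k (fun x => op_a L x i j)),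
      forall i, bounded_measurable (fun x => op_b L x 0 i)
    & bounded_measurable (op_kappa L)].

Definition uniformly_elliptic (L : diffop) : Prop :=
  exists2 c : R, 0 < c & forall x (xi : 'rV[R]_n), Omega x ->
    c * enorm xi ^+ 2 <= \sum_i \sum_j op_a L x i j * xi 0 i * xi 0 j.

Definition classical_op (L : diffop) (v : 'rV[R]_n -> R) (x : 'rV[R]_n) : R :=
  - (\sum_i \sum_j op_a L x i j * partial i (partial j v) x)
  + dotp (op_b L x) (grad v x) + op_kappa L x * v x.

(* <L v, phi>, after one integration by parts in the second-order term; G is
   the weak gradient of v. *)
Definition weak_op (L : diffop) (v : 'rV[R]_n -> R)
    (G : 'rV[R]_n -> 'rV[R]_n) (phi : 'rV[R]_n -> R) : R :=
  \int[lam]_(x in Omega)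
    (\sum_i \sum_j G x 0 i * partial j (fun y => op_a L y i j * phi y) x
     + dotp (op_b L x) (G x) * phi x + op_kappa L x * v x * phi x).

(* The dual norm over the unit ball of H^1_0, in which test functions are
   dense. As above, the infimum ranges over at most one value and is +oo when
   v is not in H^1. *)
Definition Hm1norm_op (L : diffop) (v : 'rV[R]_n -> R) : \bar R :=
  ereal_inf [set t | exists2 G, weak_grad v G &
    t = ereal_sup [set `|weak_op L v G phi|%:E | phi in
          [set phi | test_function lo hi phi /\
                     (H1norm phi (grad phi) <= 1)%E]]].

Definition weak_solution (L : diffop) (f v : 'rV[R]_n -> R)
    (G : 'rV[R]_n -> 'rV[R]_n) : Prop :=
  forall phi, test_function lo hi phi ->
    lam.-integrable Omega (fun x => (f x * phi x)%:E) /\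
    weak_op L v G phi = \int[lam]_(x in Omega) (f x * phi x).

(* Up to a null set, the boundary of the box is the union of its 2n faces
   {x_i = lo_i}, {x_i = hi_i}; a face is parametrized by the n - 1 remaining
   coordinates, and the surface measure on it is Lebesgue measure. *)

Definition face (i : 'I_n) : set 'rV[R]_n.-1 :=
  box (\row_k lo 0 (lift i k)) (\row_k hi 0 (lift i k)).

Definition face_point (i : 'I_n) (upper : bool) (y : 'rV[R]_n.-1) : 'rV[R]_n :=
  \row_j if unlift i j is Some k then y 0 k
         else if upper then hi 0 i else lo 0 i.

Definition boundary_ae (P : 'rV[R]_n -> Prop) : Prop :=
  forall (i : 'I_n) (upper : bool),
    {ae @lebesgue n.-1, forall y, face i y -> P (face_point i upper y)}.

Definition boundary_measurable (t : 'rV[R]_n -> R) : Prop :=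
  forall (i : 'I_n) (upper : bool),
    measurable_fun (face i) (t \o face_point i upper).

Definition boundary_L2norm (t : 'rV[R]_n -> R) : \bar R :=
  ((\sum_(i < n) \sum_(upper : bool)
     \int[@lebesgue n.-1]_(y in face i) (t (face_point i upper y) ^+ 2)%R%:E)
   `^ 2^-1)%E.

(* The trace is the bounded linear operator H^1(Omega) -> L^2(boundary) that
   restricts functions continuous up to the boundary. Boundary functions are
   represented by functions on R^n, up to boundary_ae equality. *)
Definition trace_operator (Tr : ('rV[R]_n -> R) -> ('rV[R]_n -> R)) : Prop :=
  [/\ forall v, in_H1 v -> boundary_measurable (Tr v),
      forall (c : R) v w, in_H1 v -> in_H1 w ->
        boundary_ae (fun x => Tr (fun y => c * v y + w y) x =
                              c * Tr v x + Tr w x),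
      exists C : R, forall v G, weak_grad v G ->
        (boundary_L2norm (Tr v) <= C%:E * H1norm v G)%E
    & forall v, in_H1 v -> {within cbox lo hi, continuous v} ->
        boundary_ae (fun x => Tr v x = v x)].

(* The norm of a space Y of boundary functions, extended by +oo outside Y *)
Definition boundary_norm (N : ('rV[R]_n -> R) -> \bar R) : Prop :=
  [/\ forall t, (0 <= N t)%E,
      forall t, N t = 0%E <-> boundary_ae (fun x => t x = 0),
      forall (c : R) t, (N t < +oo)%E ->
        N (fun x => (c * t x)%R) = (`|c|%:E * N t)%E,
      forall t t', (N (fun x => (t x + t' x)%R) <= N t + N t')%E
    & forall t t', boundary_ae (fun x => t x = t' x) -> N t = N t'].

Definition residual_norm (L : diffop) (omega : R)
    (Tr : ('rV[R]_n -> R) -> ('rV[R]_n -> R))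
    (N : ('rV[R]_n -> R) -> \bar R) (v : 'rV[R]_n -> R) : \bar R :=
  (Hm1norm_op L v + omega%:E * N (Tr v))%E.

End sobolev.

Definition grad_cov n (mu : {measure set 'rV[R]_n -> \bar R})
    (D : set 'rV[R]_n) (G : 'rV[R]_n -> 'rV[R]_n) : 'M[R]_n :=
  \matrix_(i, j) \int[mu]_(x in D) (G x 0 i * G x 0 j).

Definition empirical_cov n N (G : 'rV[R]_n -> 'rV[R]_n)
    (x : 'I_N -> 'rV[R]_n) : 'M[R]_n :=
  N%:R^-1 *: \sum_k (G (x k))^T *m G (x k).

(* The columns of U are an orthonormal basis of eigenvectors of C; nu lists
   the eigenvalues with multiplicity, in decreasing order. *)
Definition eigenbasis n (C U : 'M[R]_n) (nu : 'rV[R]_n) : Prop :=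
  [/\ U^T *m U = 1%:M, C *m U = U *m diag_mx nu
    & forall i j : 'I_n, (i <= j)%N -> nu 0 j <= nu 0 i].

Definition leading_basis n r (rn : (r <= n)%N) (C : 'M[R]_n)
    (W : 'M[R]_(n, r)) : Prop :=
  W^T *m W = 1%:M /\ exists U nu, eigenbasis C U nu /\
    (W^T == (colsub (widen_ord rn) U)^T)%MS.

(* The cosines of the principal angles are the singular values of W1^T W2. *)
Definition principal_angles n r (W1 W2 : 'M[R]_(n, r)) (Theta : 'rV[R]_r) :=
  (forall i, 0 <= Theta 0 i <= pi / 2) /\
  exists U V : 'M[R]_r, [/\ U^T *m U = 1%:M, V^T *m V = 1%:M
    & W1^T *m W2 = U *m diag_mx (map_mx cos Theta) *m V^T].

Definition sin_angles_norm r (Theta : 'rV[R]_r) : R :=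
  opnorm (diag_mx (map_mx sin Theta)).

Definition nfeat d (M : nat -> nat) (S : {set 'I_d}) : nat :=
  if S == finset.set0 then 1%N else M #|S|.

Record coord_params d := CoordParams {
  cp_omega : forall S : {set 'I_d}, nat -> 'rV[R]_#|S|;
  cp_b : {set 'I_d} -> nat -> R }.

Record glob_params r := GlobParams {
  gp_xi : nat -> 'rV[R]_r;
  gp_b : nat -> R }.

Record coefs d (M : nat -> nat) (Mglob : nat) := Coefs {
  c_coord : forall S : {set 'I_d}, 'rV[R]_(nfeat M S);
  c_glob : 'rV[R]_Mglob }.

Section trial.
Context (s : R -> R) (d r : nat) (M : nat -> nat) (Mglob : nat).
Context (A : {set {set 'I_d}}).

(* The block of the empty set consists of the constants. *)
Definition block_fun (p : coord_params d) (S : {set 'I_d})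
    (c : 'rV[R]_(nfeat M S)) (y : 'rV[R]_#|S|) : R :=
  \sum_m c 0 m * (if S == finset.set0 then 1
                  else s (dotp (cp_omega p S m) y + cp_b p S m)).

Definition block_space (p : coord_params d) (S : {set 'I_d}) :
    set ('rV[R]_#|S| -> R) :=
  [set block_fun p c | c in [set: 'rV[R]_(nfeat M S)]].

Definition coord_fun (p : coord_params d)
    (c : forall S : {set 'I_d}, 'rV[R]_(nfeat M S)) (x : 'rV[R]_d) : R :=
  \sum_(S in A) block_fun p (c S) (restr S x).

Definition glob_fun (W : 'M[R]_(d, r)) (p : glob_params r)
    (c : 'rV[R]_Mglob) (x : 'rV[R]_d) : R :=
  \sum_m c 0 m * s (dotp (gp_xi p m *m W^T) x + gp_b p m).

Definition glob_space (W : 'M[R]_(d, r)) (p : glob_params r) :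
    set ('rV[R]_d -> R) :=
  [set glob_fun W p c | c in [set: 'rV[R]_Mglob]].

Definition joint_fun (p : coord_params d) (W : 'M[R]_(d, r))
    (q : glob_params r) (c : coefs d M Mglob) (x : 'rV[R]_d) : R :=
  coord_fun p (c_coord c) x + glob_fun W q (c_glob c) x.

Definition coef_norm (c : coefs d M Mglob) : R :=
  Num.sqrt (\sum_(S in A) \sum_m c_coord c S 0 m ^+ 2
            + \sum_m c_glob c 0 m ^+ 2).

Definition collocation_loss (L : diffop d) (f g : 'rV[R]_d -> R)
    (omega_bc lambda : R) Nint (xint : 'I_Nint -> 'rV[R]_d)
    Nbc (xbc : 'I_Nbc -> 'rV[R]_d)
    (p : coord_params d) (W : 'M[R]_(d, r)) (q : glob_params r)
    (c : coefs d M Mglob) : R :=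
  let v := joint_fun p W q c in
  Nint%:R^-1 * (\sum_k (classical_op L v (xint k) - f (xint k)) ^+ 2)
  + omega_bc ^+ 2 / Nbc%:R * (\sum_k (v (xbc k) - g (xbc k)) ^+ 2)
  + lambda * coef_norm c ^+ 2.

(* E_k^c, from the single-block errors e S M_k rho eta *)
Definition nblk k : nat := #|[set S in A | #|S| == k]|.

Definition Kmax : nat := (\max_(S in A) #|S|)%N.

Definition block_error (e : {set 'I_d} -> nat -> R -> R -> R)
    (rho : R) (k : nat) (eta : R) : R :=
  Num.sqrt (\sum_(S in A | #|S| == k)
              e S (M k) rho (eta / (Kmax%:R * (nblk k)%:R)) ^+ 2).

End trial.

Definition with_probability d (T : measurableType d) (P : probability T R)
    (p : R) (E : set T) : Prop :=
  exists E', [/\ measurable E', E' `<=` E & (p%:E <= P E')%E].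

(* The sample X is i.i.d. with law mu and independent of <<s G >>. *)
Definition iid_indep d (T : measurableType d) (P : probability T R) n
    (mu : {measure set 'rV[R]_n -> \bar R}) (G : set (set T))
    N (X : 'I_N -> T -> 'rV[R]_n) : Prop :=
  forall (E : set T) (B : 'I_N -> set 'rV[R]_n),
    <<s G >> E -> (forall k, measurable (B k)) ->
    P (E `&` [set w | forall k, B k (X k w)]) =
    (P E * (\prod_k fine (mu (B k)))%:E)%E.

(* Events determined by the values of the random function v and by the random
   points X and Y *)
Definition generating_events (T : Type) n (v : T -> 'rV[R]_n -> R)
    N (X : 'I_N -> T -> 'rV[R]_n) N' (Y : 'I_N' -> T -> 'rV[R]_n) :
    set (set T) :=
  [set E | (exists x (B : set (measurableTypeR R)),
              measurable B /\ E = [set w | B (v w x)])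
        \/ (exists k (B : set 'rV[R]_n), measurable B /\ E = X k @^-1` B)
        \/ (exists k (B : set 'rV[R]_n), measurable B /\ E = Y k @^-1` B)].

Definition measurable_coord_params d (T : measurableType d) n
    (p : T -> coord_params n) : Prop :=
  forall S m, measurable_fun [set: T] (fun w => cp_omega (p w) S m) /\
              measurable_fun [set: T] (fun w => cp_b (p w) S m).

Definition measurable_glob_params d (T : measurableType d) n
    (p : T -> glob_params n) : Prop :=
  forall m, measurable_fun [set: T] (fun w => gp_xi (p w) m) /\
            measurable_fun [set: T] (fun w => gp_b (p w) m).

End setting.

Arguments block_space {R} s {d} M p S _.

(* Main.v *)
(** Deterministic part.  With [e := sum_S z_S + (h - h_Q) + (h_Q - v_AS)] one
    has [u - uhat = u_perp + (e + (u^dagger - uhat))] almost everywhere, so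
    elliptic stability reduces the error to residual norms, and the joint
    least-squares estimate is applied with [u - u^dagger = e + u_perp].  This
    needs the residual norm to be subadditive and insensitive to null sets.
    For the [H^-1] part weak gradients are added, without any appeal to their
    uniqueness; for the trace, a function vanishing almost everywhere has weak
    gradient 0, hence trace 0 by boundedness of the trace operator.

    Angle bound.  Let [x] be the unit vector of the leading space of [C]
    realizing the principal angle with sine [s] and cosine [c], let [a] be its
    partner in the leading space of [Chat], and let [y := x - c a].  Then
    [|y| = s], [y] is orthogonal to the leading space of [Chat], and [y - s^2 x]
    is orthogonal to the leading space of [C].  Comparing [<y C, x>] with
    [<y Chat, x>] gives [s (nu_r - nuhat_(r+1)) <= |Chat - C|], and Weyl's
    inequality bounds [nuhat_(r+1)] by [nu_(r+1) + |Chat - C|].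

    Probability.  The budget of the block events sums to at most [eta_feat]; the
    rest is a union bound over inner measurable events. *)

Require Import Defs.
From HB Require Import structures.
From mathcomp Require Import all_boot all_order all_algebra.
From mathcomp Require Import all_classical all_reals all_analysis.
From mathcomp Require Import measurable_realfun ring lra.
Import Order.TTheory GRing.Theory Num.Theory.
Import numFieldNormedType.Exports.
Local Open Scope classical_set_scope.
Local Open Scope ring_scope.
Set Implicit Arguments. Unset Strict Implicit. Unset Printing Implicit Defensive.

(** * Euclidean norm and operator norm on row vectors *)

Section euclidean.
Context (R : realType).
Implicit Types n m : nat.

Lemma dotpE n (x y : 'rV[R]_n) : dotp x y = (x *m y^T) 0 0.
Proof. by rewrite !mxE; apply: eq_bigr => i _; rewrite mxE. Qed.

Lemma dotpC n (x y : 'rV[R]_n) : dotp x y = dotp y x.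
Proof. by apply: eq_bigr => i _; rewrite mulrC. Qed.

Lemma dotpDl n (x y z : 'rV[R]_n) : dotp (x + y) z = dotp x z + dotp y z.
Proof. by rewrite !dotpE mulmxDl mxE. Qed.

Lemma dotpZl n a (x z : 'rV[R]_n) : dotp (a *: x) z = a * dotp x z.
Proof. by rewrite !dotpE -scalemxAl mxE. Qed.

Lemma dotpNl n (x z : 'rV[R]_n) : dotp (- x) z = - dotp x z.
Proof. by rewrite !dotpE mulNmx mxE. Qed.

Lemma dotpBl n (x y z : 'rV[R]_n) : dotp (x - y) z = dotp x z - dotp y z.
Proof. by rewrite dotpDl dotpNl. Qed.

Lemma dotpBr n (x y z : 'rV[R]_n) : dotp z (x - y) = dotp z x - dotp z y.
Proof. by rewrite !(dotpC z) dotpBl. Qed.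

Lemma dotpZr n a (x z : 'rV[R]_n) : dotp z (a *: x) = a * dotp z x.
Proof. by rewrite !(dotpC z) dotpZl. Qed.

Lemma dotp_mulmx n m (x : 'rV[R]_n) (A : 'M[R]_(n, m)) (y : 'rV[R]_m) :
  dotp (x *m A) y = dotp x (y *m A^T).
Proof. by rewrite !dotpE trmx_mul trmxK mulmxA. Qed.

Lemma dotp_ge0 n (x : 'rV[R]_n) : 0 <= dotp x x.
Proof. by apply: sumr_ge0 => i _; rewrite -expr2 sqr_ge0. Qed.

Lemma dotp_eq0 n (x : 'rV[R]_n) : (dotp x x == 0) = (x == 0).
Proof.
apply/eqP/eqP => [/eqP|->]; last by rewrite dotpE mul0mx mxE.
rewrite psumr_eq0 => [/allP x0|i _]; last by rewrite -expr2 sqr_ge0.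
apply/rowP => i; have /(_ (mem_index_enum i)) := x0 i.
by rewrite mulf_eq0 orbb mxE => /eqP.
Qed.

Lemma enorm_ge0 n (x : 'rV[R]_n) : 0 <= enorm x.
Proof. exact: sqrtr_ge0. Qed.

Lemma sqr_enorm n (x : 'rV[R]_n) : enorm x ^+ 2 = dotp x x.
Proof. by rewrite sqr_sqrtr// dotp_ge0. Qed.

Lemma enorm0 n : enorm (0 : 'rV[R]_n) = 0.
Proof. by apply/eqP; rewrite sqrtr_eq0 dotpE mul0mx mxE. Qed.

Lemma enormZ n a (x : 'rV[R]_n) : enorm (a *: x) = `|a| * enorm x.
Proof.
by rewrite /enorm dotpZl dotpZr mulrA -expr2 sqrtrM ?sqr_ge0// sqrtr_sqr.
Qed.

Lemma enormN n (x : 'rV[R]_n) : enorm (- x) = enorm x.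
Proof. by rewrite -scaleN1r enormZ normrN1 mul1r. Qed.

Lemma cauchy_schwarz n (x y : 'rV[R]_n) : `|dotp x y| <= enorm x * enorm y.
Proof.
rewrite -(@ler_pXn2r _ 2)// ?nnegrE ?mulr_ge0 ?enorm_ge0//.
rewrite real_normK ?num_real// exprMn !sqr_enorm.
have [->|y0] := eqVneq y 0.
  by rewrite dotpC !dotpE !mul0mx !mxE expr0n mulr0.
have yy : 0 < dotp y y by rewrite lt_neqAle dotp_ge0 eq_sym dotp_eq0 y0.
(* This vector is [dotp y y] times the component of [x] orthogonal to [y]; with the abbreviations
   below its squared norm is [c * (a * c - b ^+ 2)]. *)
have := dotp_ge0 (dotp y y *: x - dotp x y *: y).
rewrite !(dotpBl, dotpBr, dotpZl, dotpZr) (dotpC y x).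
set a := dotp x x; set b := dotp x y; set c := dotp y y.
rewrite (_ : _ - _ = c * (a * c - b ^+ 2)); first by rewrite pmulr_rge0// subr_ge0.
by ring.
Qed.

Lemma ler_enormD n (x y : 'rV[R]_n) : enorm (x + y) <= enorm x + enorm y.
Proof.
rewrite -(@ler_pXn2r _ 2)// ?nnegrE ?addr_ge0 ?enorm_ge0// sqr_enorm sqrrD.
rewrite dotpDl !(dotpC _ (x + y)) !dotpDl !sqr_enorm (dotpC y x).
have := le_trans (ler_norm _) (cauchy_schwarz x y); lra.
Qed.

(** Normalization that also covers [x = 0], so that the scaling argument for [opnormP] needs no case
    distinction. *)
Lemma enorm_unit n (x : 'rV[R]_n) : exists2 y, enorm y <= 1 & x = enorm x *: y.
Proof.
have [x0|x0] := eqVneq (enorm x) 0.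
  exists 0; first by rewrite enorm0.
  by apply/eqP; rewrite x0 scale0r -dotp_eq0 -sqr_enorm x0 expr0n.
exists ((enorm x)^-1 *: x); last by rewrite scalerA divff// scale1r.
by rewrite enormZ normfV ger0_norm ?enorm_ge0// mulVf.
Qed.

(** The real-valued [sup] is meaningful only for nonempty bounded sets. Cauchy-Schwarz on each row
    of [A] bounds this one by the Frobenius norm. *)
Lemma has_sup_opnorm n m (A : 'M[R]_(m, n)) :
  has_sup [set enorm (x *m A^T) | x in [set x : 'rV[R]_n | enorm x <= 1]].
Proof.
split; first by exists (enorm (0 *m A^T)), 0 => //=; rewrite enorm0.
exists (Num.sqrt (\sum_j enorm (row j A) ^+ 2)) => _ [x /= x1 <-].
rewrite ler_sqrt; last by apply: sumr_ge0 => j _; exact: sqr_ge0.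
apply: ler_sum => j _; rewrite -expr2 -[leLHS]real_normK ?num_real//.
rewrite ler_pXn2r ?nnegrE ?enorm_ge0//.
have -> : (x *m A^T) 0 j = dotp x (row j A).
  by rewrite !mxE; apply: eq_bigr => i _; rewrite !mxE.
apply: le_trans (cauchy_schwarz _ _) _.
by rewrite ler_piMl ?enorm_ge0.
Qed.

Lemma opnormP n m (A : 'M[R]_(m, n)) (x : 'rV[R]_n) :
  enorm (x *m A^T) <= opnorm A * enorm x.
Proof.
have [y y1 {1}->] := enorm_unit x.
rewrite -scalemxAl enormZ ger0_norm ?enorm_ge0// mulrC ler_wpM2r ?enorm_ge0//.
by apply: ub_le_sup; [exact: (has_sup_opnorm A).2|exists y].
Qed.

Lemma opnorm_le n m (A : 'M[R]_(m, n)) (K : R) :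
  (forall x : 'rV[R]_n, enorm x <= 1 -> enorm (x *m A^T) <= K) -> opnorm A <= K.
Proof.
move=> AK; apply: ge_sup; first exact: (has_sup_opnorm A).1.
by move=> _ [x x1 <-]; exact: AK.
Qed.

Lemma opnorm_ge0 n m (A : 'M[R]_(m, n)) : 0 <= opnorm A.
Proof.
apply: ub_le_sup; first exact: (has_sup_opnorm A).2.
by exists 0; rewrite /= ?mul0mx enorm0.
Qed.

Lemma ler_opnormD n m (A B : 'M[R]_(m, n)) :
  opnorm (A + B) <= opnorm A + opnorm B.
Proof.
apply: opnorm_le => x x1; rewrite linearD/= mulmxDr.
apply: le_trans (ler_enormD _ _) _; apply: lerD;
  apply: le_trans (opnormP _ _) _; by rewrite ler_piMr ?opnorm_ge0.
Qed.

Lemma dotp_opnorm n m (A : 'M[R]_(m, n)) (x : 'rV[R]_n) (y : 'rV[R]_m) :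
  `|dotp (x *m A^T) y| <= opnorm A * enorm x * enorm y.
Proof.
apply: le_trans (cauchy_schwarz _ _) _.
by rewrite ler_wpM2r ?enorm_ge0// opnormP.
Qed.

(** The choice [y := x *m A^T] turns the form into a squared norm, so a one-sided bound is
    enough. *)
Lemma opnorm_bilinear n m (A : 'M[R]_(m, n)) (K : R) : 0 <= K ->
  (forall x y, dotp (x *m A^T) y <= K * enorm x * enorm y) -> opnorm A <= K.
Proof.
move=> K0 AK; apply: opnorm_le => x x1.
have := AK x (x *m A^T); rewrite -sqr_enorm.
have [->|z0] := eqVneq (enorm (x *m A^T)) 0; first by [].
have zgt0 : 0 < enorm (x *m A^T) by rewrite lt_neqAle enorm_ge0 eq_sym z0.
rewrite expr2 ler_pM2r// => /le_trans; apply.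
by rewrite ler_piMr.
Qed.

Lemma opnorm_diag_le n (v : 'rV[R]_n) (K : R) :
  (forall i, `|v 0 i| <= K) -> 0 <= K -> opnorm (diag_mx v) <= K.
Proof.
move=> vK K0; apply: opnorm_bilinear => // x y.
apply: le_trans (ler_norm _) _; apply: le_trans (cauchy_schwarz _ _) _.
rewrite ler_wpM2r ?enorm_ge0// -(@ler_pXn2r _ 2)// ?nnegrE ?mulr_ge0 ?enorm_ge0//.
rewrite exprMn !sqr_enorm /dotp mulr_sumr; apply: ler_sum => i _.
rewrite tr_diag_mx mul_mx_diag !mxE -!expr2 exprMn mulrC ler_wpM2r ?sqr_ge0//.
by rewrite -[leLHS]real_normK ?num_real// ler_pXn2r ?nnegrE.
Qed.

End euclidean.

(** * Eigenvalue inequalities and the angle between leading eigenspaces *)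

Section spectral.
Context (R : realType).

Lemma eigenbasis_tr n (C U : 'M[R]_n) nu : eigenbasis C U nu -> U *m U^T = 1%:M.
Proof. by case=> /mulmx1C. Qed.

Lemma dotp_eigenbasis n (C U : 'M[R]_n) nu (x y : 'rV[R]_n) :
  eigenbasis C U nu -> dotp (x *m U) (y *m U) = dotp x y.
Proof. by move=> /eigenbasis_tr UU; rewrite dotp_mulmx -mulmxA UU mulmx1. Qed.

Lemma eigenbasis_form n (C U : 'M[R]_n) nu (x y : 'rV[R]_n) :
  eigenbasis C U nu ->
  dotp (x *m C) y = \sum_i nu 0 i * (x *m U) 0 i * (y *m U) 0 i.
Proof.
move=> CU; have [_ CUE _] := CU.
rewrite -(dotp_eigenbasis _ _ CU) -mulmxA CUE mulmxA mul_mx_diag.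
by apply: eq_bigr => i _; rewrite !mxE; congr (_ * _); rewrite mulrC.
Qed.

(** Rayleigh quotient on the span of the leading [k + 1] eigenvectors: in eigencoordinates only
    eigenvalues at least [nu 0 k] carry weight. The next lemma is the counterpart for the trailing
    ones. *)
Lemma eigenbasis_form_ge n (C U : 'M[R]_n) nu (x : 'rV[R]_n) (k : 'I_n) :
  eigenbasis C U nu -> (forall i : 'I_n, (k < i)%N -> (x *m U) 0 i = 0) ->
  nu 0 k * dotp x x <= dotp (x *m C) x.
Proof.
move=> CU x0; rewrite (eigenbasis_form _ _ CU) -(dotp_eigenbasis _ _ CU).
rewrite /dotp mulr_sumr; apply: ler_sum => i _; rewrite -mulrA.
have [/x0->|ik] := ltnP k i; first by rewrite !mul0r !mulr0.
by rewrite ler_wpM2r -?expr2 ?sqr_ge0//; case: CU => _ _; exact.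
Qed.

Lemma eigenbasis_form_le n (C U : 'M[R]_n) nu (x : 'rV[R]_n) (k : 'I_n) :
  eigenbasis C U nu -> (forall i : 'I_n, (i < k)%N -> (x *m U) 0 i = 0) ->
  dotp (x *m C) x <= nu 0 k * dotp x x.
Proof.
move=> CU x0; rewrite (eigenbasis_form _ _ CU) -(dotp_eigenbasis _ _ CU).
rewrite /dotp mulr_sumr; apply: ler_sum => i _; rewrite -mulrA.
have [/x0->|ik] := ltnP i k; first by rewrite !mul0r !mulr0.
by rewrite ler_wpM2r -?expr2 ?sqr_ge0//; case: CU => _ _; exact.
Qed.

Lemma colsub_mulmx n m p q (f : 'I_q -> 'I_p) (A : 'M[R]_(m, n)) (B : 'M[R]_(n, p)) :
  A *m colsub f B = colsub f (A *m B).
Proof. by apply/matrixP => i j; rewrite !mxE; apply: eq_bigr => l _; rewrite mxE. Qed.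

Lemma colsub_eq0 m p q (f : 'I_q -> 'I_p) (A : 'M[R]_(m, p)) i j :
  colsub f A = 0 -> A i (f j) = 0.
Proof. by move=> /matrixP/(_ i j); rewrite !mxE. Qed.

(* The leading [k + 1] eigenvectors of the first matrix and the trailing
   [n - k] of the second span subspaces that meet nontrivially. *)
Lemma weyl n (C U C' U' : 'M[R]_n) nu nu' (eps : R) :
  eigenbasis C U nu -> eigenbasis C' U' nu' ->
  (forall z, dotp (z *m C) z <= dotp (z *m C') z + eps * dotp z z) ->
  forall k, nu 0 k <= nu' 0 k + eps.
Proof.
move=> CU CU' CC' k.
have kn : (k.+1 <= n)%N by [].
pose Uk := colsub (widen_ord kn) U.
pose Uk' := colsub (widen_ord (ltnW kn)) U'.
(* The product has [k + 1] rows but only [k] columns, so its left kernel is nonzero. The resulting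
   [z] is a combination of the columns of [Uk] and is orthogonal to those of [Uk']. *)
have [v v0 vM] : exists2 v : 'rV[R]_k.+1, v != 0 & v *m (Uk^T *m Uk') = 0.
  pose v := nz_row (kermx (Uk^T *m Uk')); exists v.
    rewrite nz_row_eq0 -mxrank_eq0 mxrank_ker subn_eq0 -ltnNge.
    exact: leq_ltn_trans (rank_leq_col _) _.
  by apply/eqP; rewrite -sub_kermx nz_row_sub.
have UkUk : Uk^T *m Uk = 1%:M.
  apply/matrixP => i j; have [/matrixP/(_ (widen_ord kn i) (widen_ord kn j)) + _ _] := CU.
  rewrite !mxE => UU; transitivity (\sum_j0 U^T (widen_ord kn i) j0 * U j0 (widen_ord kn j)).
    by apply: eq_bigr => l _; rewrite !mxE.
  by rewrite UU.
pose z := v *m Uk^T.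
have z0 : z != 0.
  apply: contra_neq v0 => z0.
  by rewrite -[v]mulmx1 -UkUk mulmxA -/z z0 mul0mx.
have zz : 0 < dotp z z by rewrite lt_neqAle dotp_ge0 eq_sym dotp_eq0 z0.
rewrite -(ler_pM2r zz) mulrDl.
apply: le_trans (_ : _ <= dotp (z *m C) z) _.
  apply: (eigenbasis_form_ge CU) => i ki.
  rewrite /z -mulmxA mxE big1// => j _.
  have -> : (Uk^T *m U) j i = (U^T *m U) (widen_ord kn j) i.
    by rewrite !mxE; apply: eq_bigr => l _; rewrite !mxE.
  case: CU => -> _ _; rewrite [X in _ * X]mxE -val_eqE/= ltn_eqF ?mulr0//.
  by rewrite (leq_trans _ ki).
apply: le_trans (CC' z) _; rewrite lerD2r.
apply: (eigenbasis_form_le CU') => i ik.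
rewrite (_ : i = widen_ord (ltnW kn) (Ordinal ik)); last exact: val_inj.
by apply: colsub_eq0; rewrite -colsub_mulmx /z -mulmxA.
Qed.

(** Weyl's inequality with zero perturbation, used both ways. It identifies the eigenvalues hidden
    inside [leading_basis] with those of a given eigenbasis. *)
Lemma eigenvalues_uniq n (C U U' : 'M[R]_n) nu nu' :
  eigenbasis C U nu -> eigenbasis C U' nu' -> nu = nu'.
Proof.
move=> CU CU'; apply/rowP => k; apply/eqP; rewrite eq_le.
have H z : dotp (z *m C) z <= dotp (z *m C) z + 0 * dotp z z by rewrite mul0r addr0.
have := weyl CU CU' H k; have := weyl CU' CU H k.
by rewrite !addr0 => -> ->.
Qed.

Section leading.
Context n r (rn : (r <= n)%N) (C : 'M[R]_n) (W : 'M[R]_(n, r)).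
Hypothesis CW : leading_basis rn C W.

(** The columns of [W] need not be eigenvectors; only their span is prescribed. The equality of row
    spaces is converted here into vanishing eigencoordinates, from [r] on for the span of [W] and
    before [r] for its orthogonal complement. *)
Lemma leading_basisP : exists U nu, [/\ eigenbasis C U nu,
  forall (v : 'rV[R]_r) (i : 'I_n), (r <= i)%N -> (v *m W^T *m U) 0 i = 0
  & forall (z : 'rV[R]_n) (i : 'I_n), z *m W = 0 -> (i < r)%N -> (z *m U) 0 i = 0].
Proof.
have [_ [U [nu [CU /andP[/submxP[D WD] /submxP[D' UD']]]]]] := CW.
exists U, nu; split=> // [v i ri|z i zW ir].
  rewrite WD -!mulmxA mulmxA mxE big1// => j _.
  have -> : ((colsub (widen_ord rn) U)^T *m U) j i = (U^T *m U) (widen_ord rn j) i.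
    by rewrite !mxE; apply: eq_bigr => l _; rewrite !mxE.
  case: CU => -> _ _; rewrite [X in _ * X]mxE -val_eqE/= ltn_eqF ?mulr0//.
  by rewrite (leq_trans _ ri).
rewrite (_ : i = widen_ord rn (Ordinal ir)); last exact: val_inj.
apply: colsub_eq0; rewrite -colsub_mulmx.
by rewrite -[colsub _ _]trmxK UD' trmx_mul trmxK mulmxA zW mul0mx.
Qed.

(** The span of [W] and its complement are invariant under [C]: in eigencoordinates every summand
    has a vanishing factor. *)
Lemma leading_basis_orth (v : 'rV[R]_r) (z : 'rV[R]_n) :
  z *m W = 0 -> dotp (z *m C) (v *m W^T) = 0.
Proof.
have [U [nu [CU W1 W2]]] := leading_basisP => zW.
rewrite (eigenbasis_form _ _ CU) big1// => i _.
have [ir|ri] := ltnP i r; first by rewrite W2// mulr0 mul0r.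
by rewrite W1// mulr0.
Qed.

End leading.

Lemma leading_basis_le n r (rn : (r < n)%N) (C U : 'M[R]_n) (W : 'M[R]_(n, r)) nu
    (z : 'rV[R]_n) :
  leading_basis (ltnW rn) C W -> eigenbasis C U nu -> z *m W = 0 ->
  dotp (z *m C) z <= nu 0 (Ordinal rn) * dotp z z.
Proof.
move=> /leading_basisP[U' [nu' [CU' _ W2]]] CU zW.
rewrite (eigenvalues_uniq CU CU'); apply: (eigenbasis_form_le CU') => i ir.
exact: W2.
Qed.

Lemma leading_basis_ge n r (rn : (r <= n)%N) (C U : 'M[R]_n) (W : 'M[R]_(n, r)) nu
    (k : 'I_n) (v : 'rV[R]_r) :
  leading_basis rn C W -> eigenbasis C U nu -> k.+1 = r ->
  nu 0 k * dotp (v *m W^T) (v *m W^T) <= dotp (v *m W^T *m C) (v *m W^T).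
Proof.
move=> /leading_basisP[U' [nu' [CU' W1 _]]] CU kr.
rewrite (eigenvalues_uniq CU CU'); apply: (eigenbasis_form_ge CU') => i ri.
by apply: W1; rewrite -kr.
Qed.

Lemma davis_kahan n r (r0 : (0 < r)%N) (rn : (r < n)%N) (C U Ch : 'M[R]_n)
    (nu : 'rV[R]_n) (W Wh : 'M[R]_(n, r)) (Theta : 'rV[R]_r) (Delta : R) :
  Delta = nu 0 (Ordinal (leq_ltn_trans (leq_pred r) rn)) - nu 0 (Ordinal rn) ->
  eigenbasis C U nu -> leading_basis (ltnW rn) C W ->
  leading_basis (ltnW rn) Ch Wh -> principal_angles Wh W Theta ->
  0 < Delta -> opnorm (Ch - C) <= Delta / 2 ->
  sin_angles_norm Theta <= 2 / Delta * opnorm (Ch - C).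
Proof.
set k := Ordinal (leq_ltn_trans _ _); set k' := Ordinal rn => DeltaE.
move=> CU CW CWh [Th [P [V [PP VV WhWE]]]] D0 ED.
set E := opnorm _ in ED *.
have E0 : 0 <= E by exact: opnorm_ge0.
have K0 : 0 <= 2 / Delta * E by rewrite mulr_ge0// divr_ge0// ltW.
(* The norm of a diagonal matrix is controlled entrywise, so a single angle remains to be
   bounded. *)
apply: opnorm_diag_le => // i; rewrite mxE.
set s := sin (Theta 0 i); set c := cos (Theta 0 i).
have s0 : 0 <= s.
  have /andP[t0 t1] := Th i; apply: sin_ge0_pi; rewrite t0/=.
  by apply: le_trans t1 _; rewrite ler_pdivrMr// ler_peMr ?pi_ge0// ler1n.
have sc : s ^+ 2 = 1 - c ^+ 2 by rewrite -(cos2Dsin2 (Theta 0 i)) addrC addKr.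
rewrite ger0_norm//.
have [Whh [Uh' [nuh' [ChU' _]]]] := CWh; have WW := CW.1.
pose ei : 'rV[R]_r := delta_mx 0 i.
have eiC : ei *m diag_mx (map_mx cos Theta) = c *: ei.
  by apply/rowP => j; rewrite mul_mx_diag !mxE eqxx/= mulrC;
    case: eqP => [->|]; rewrite ?mulr0.
(* The [i]-th columns of [W *m V] and [Wh *m P], written as rows: the [i]-th pair of principal
   vectors. *)
pose x := ei *m V^T *m W^T; pose a := ei *m P^T *m Wh^T.
have WhW : W^T *m Wh = V *m diag_mx (map_mx cos Theta) *m P^T.
  by rewrite -[LHS]trmxK trmx_mul trmxK WhWE !trmx_mul trmxK tr_diag_mx mulmxA.
have xWh : x *m Wh = c *: (ei *m P^T).
  rewrite /x -mulmxA WhW !mulmxA -(mulmxA ei) VV mulmx1 eiC.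
  by rewrite -scalemxAl.
have aW : a *m W = c *: (ei *m V^T).
  by rewrite /a -mulmxA WhWE !mulmxA -(mulmxA ei) PP mulmx1 eiC -scalemxAl.
have xW : x *m W = ei *m V^T by rewrite /x -mulmxA WW mulmx1.
have aWh : a *m Wh = ei *m P^T by rewrite /a -mulmxA Whh mulmx1.
have ee (Q : 'M[R]_r) : Q^T *m Q = 1%:M -> dotp (ei *m Q^T) (ei *m Q^T) = 1.
  move=> QQ; rewrite dotp_mulmx trmxK -mulmxA QQ mulmx1 /dotp (bigD1 i)//=.
  by rewrite big1 => [|j ji]; rewrite !mxE ?eqxx ?mulr1 ?addr0// (negbTE ji) mulr0.
have xx : dotp x x = 1 by rewrite {1}/x dotp_mulmx trmxK xW ee.
have xa : dotp x a = c.
  by rewrite /a dotpC dotp_mulmx trmxK xWh dotpZr ee// mulr1.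
pose y := x - c *: a.
have yWh : y *m Wh = 0.
  by rewrite /y mulmxBl -scalemxAl xWh aWh subrr.
have yxW : (y - s ^+ 2 *: x) *m W = 0.
  rewrite /y !mulmxBl -!scalemxAl xW aW scalerA -expr2 sc scalerBl scale1r.
  by rewrite subrr.
have ya : dotp y a = 0 by rewrite /a dotpC dotp_mulmx trmxK yWh dotpC dotpE mul0mx mxE.
have yy : dotp y y = s ^+ 2.
  rewrite {2}/y dotpBr dotpZr ya mulr0 subr0 /y dotpBl dotpZl xx (dotpC a) xa.
  by rewrite sc -expr2.
have yn : enorm y = s by rewrite /enorm yy sqrtr_sqr ger0_norm.
have xn : enorm x = 1 by rewrite /enorm xx sqrtr1.
(* Write [y] as [(y - s ^+ 2 *: x) + s ^+ 2 *: x]. The first part is orthogonal to [W], so its cross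
   term with [x] vanishes; the second is a Rayleigh quotient on the span of [W]. *)
have yCx : s ^+ 2 * nu 0 k <= dotp (y *m C) x.
  rewrite -[y in leRHS](subrK (s ^+ 2 *: x)) mulmxDl dotpDl.
  rewrite {2}/x (leading_basis_orth CW)// add0r -scalemxAl dotpZl.
  rewrite ler_wpM2l ?sqr_ge0// -[leLHS]mulr1 -xx.
  by apply: (leading_basis_ge _ CW CU); rewrite /= prednK.
have yChx : dotp (y *m Ch) x <= nuh' 0 k' * s ^+ 2.
  rewrite -[x](subrK (c *: a)) dotpC dotpDl !(dotpC _ (y *m Ch)).
  rewrite dotpZr (leading_basis_orth CWh)// mulr0 addr0 -/y -yy.
  exact: leading_basis_le CWh ChU' yWh.
have nuE : nuh' 0 k' <= nu 0 k' + E.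
  apply: (weyl ChU' CU) => z.
  rewrite -lerBlDl -dotpBl -mulmxBr dotp_mulmx dotpC -sqr_enorm expr2 mulrA.
  exact: le_trans (ler_norm _) (dotp_opnorm (Ch - C) z z).
have yE : dotp (y *m C) x - dotp (y *m Ch) x <= E * s.
  rewrite -dotpBl -mulmxBr dotp_mulmx dotpC -opprB linearN/= mulmxN dotpNl.
  apply: le_trans (ler_norm _) _; rewrite normrN.
  by apply: le_trans (dotp_opnorm _ _ _) _; rewrite xn yn mulr1.
have [->//|sn0] := eqVneq s 0.
have spos : 0 < s by rewrite lt_neqAle eq_sym sn0.
rewrite mulrAC ler_pdivlMr//.
(* The three estimates on [y] and [x] carry a common factor [s], which is cancelled here; this is
   why [s = 0] was set aside. *)
have key : s * (nu 0 k - nuh' 0 k') <= E.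
  rewrite -(ler_pM2r spos); apply: le_trans yE.
  by move: yCx yChx; nra.
have : s * (Delta - E) <= E.
  apply: le_trans key; rewrite ler_wpM2l// DeltaE; move: nuE; lra.
(* The perturbation [E] uses up at most half of the gap; the remaining half produces the constant
   [2 / Delta]. *)
have : s * (Delta / 2) <= s * (Delta - E) by rewrite ler_wpM2l//; lra.
lra.
Qed.

End spectral.

(** * Open sets, boxes and continuous functions are compatible with the product sigma-algebra *)

Section measurability.
Context (R : realType) (n : nat).
Implicit Types (v w : 'rV[R]_n -> R) (lo hi : 'rV[R]_n).

Lemma measurable_coordinatewise (B : 'I_n -> set (measurableTypeR R)) :
  (forall i, measurable (B i)) -> measurable [set x : 'rV[R]_n | forall i, B i (x 0 i)].
Proof.
move=> mB.
have -> : [set x : 'rV[R]_n | forall i, B i (x 0 i)] =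
    \bigcap_(i in [set: 'I_n]) ((fun x : 'rV[R]_n => x 0 i) @^-1` B i).
  by apply/seteqP; split=> x /= Bx i; [move=> _|]; exact: Bx.
apply: fin_bigcap_measurable => [|i _]; first exact: finite_finset.
by rewrite -[X in measurable X]setTI; apply: measurable_rV_coord => //; exact: mB.
Qed.

Let width (k : nat) : R := k.+1%:R^-1.

(** Open cubes with rational centres and radii [1 / (k + 1)]: a base of the topology indexed by a
    countable type. *)
Let cube (c : 'rV[rat]_n * nat) : set 'rV[R]_n :=
  [set x | forall i, `]ratr (c.1 0 i) - width c.2, ratr (c.1 0 i) + width c.2[%classic
                     (x 0 i)].

(** The sigma-algebra is generated by the coordinates, so its open sets have to be recovered: an
    open set is the countable union of the rational cubes that it contains. *)
Lemma open_measurable_rV (U : set 'rV[R]_n) : open U -> measurable U.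
Proof.
move=> oU.
have -> : U = \bigcup_c (if `[< cube c `<=` U >] then cube c else set0).
  apply/seteqP; split=> x /=; last by case=> c _; case: ifPn => // /asboolP; exact.
  rewrite openE in oU => /oU /nbhs_ballP[e /= e0 eU].
  (* Half of [e], because the centre of the cube is itself only within [width k] of [x]. *)
  have [k ke] : exists k : nat, width k < e / 2.
    exists (Num.bound (e / 2)^-1).
    rewrite /width invf_plt ?posrE ?divr_gt0//.
    have := archi_boundP (ltW (_ : 0 < (e / 2)^-1)).
    rewrite invr_gt0 divr_gt0// => /(_ isT) /lt_le_trans; apply.
    by rewrite ler_nat.
  have k0 : 0 < width k by rewrite invr_gt0.
  have /choice[c cx] : forall i, exists q : rat,
      ratr q \in `]x 0 i - width k, x 0 i + width k[.
    by move=> i; apply: rat_in_itvoo; lra.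
  have xc : cube (\row_i c i, k) x.
    move=> i; rewrite /= in_itv/= mxE.
    by have := cx i; rewrite in_itv/= => /andP[? ?]; apply/andP; split; lra.
  exists (\row_i c i, k) => //; case: ifPn => // /asboolP[] y yc.
  apply: eU; split=> // i j; rewrite ord1 /ball/=; move: (xc j) (yc j); rewrite /= !in_itv/=.
  by move=> /andP[? ?] /andP[? ?]; rewrite ltr_norml; apply/andP; split; lra.
apply: countable_bigcupT_measurable; first exact: countableP.
move=> c; case: ifP => // _.
apply: (measurable_coordinatewise (B := fun i =>
  `]ratr (c.1 0 i) - width c.2, ratr (c.1 0 i) + width c.2[%classic)) => i.
exact: measurable_itv.
Qed.

Lemma continuous_measurable_rV v : continuous v -> measurable_fun setT v.
Proof.
move=> /continuousP cv; apply: (measurability _ (RGenOpens.measurableE R)).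
move=> _ [_ [a [b ->] <-]]; rewrite setTI; apply: open_measurable_rV.
exact/cv/interval_open.
Qed.

Lemma measurable_box lo hi : measurable (box lo hi).
Proof.
apply: (measurable_coordinatewise (B := fun i => `]lo 0 i, hi 0 i[%classic)) => i.
exact: measurable_itv.
Qed.

Lemma lebesgue_box_lty lo hi : (lebesgue R n (box lo hi) < +oo)%E.
Proof.
have -> : box lo hi = [set x | forall i, `]lo 0 i, hi 0 i[%classic (x 0 i)] by [].
rewrite (prod_measureE _ (B := fun i => `]lo 0 i, hi 0 i[%classic)); last first.
  by move=> i; exact: measurable_itv.
set P := (X in (X < _)%E); suff /andP[] : (0 <= P < +oo)%E by [].
rewrite {}/P; elim/big_ind : _ => [|a b /andP[a0 ay] /andP[b0 bY]|i _].
    by rewrite lee_fin ler01 ltry.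
  by rewrite mule_ge0//= lte_mul_pinfty// ge0_fin_numE.
by rewrite measure_ge0/= lebesgue_measure_itv/=; case: ifP => _; rewrite ltry.
Qed.

(** The open box lies in a product of segments, which is compact. *)
Lemma continuous_bounded_box lo hi v : continuous v ->
  exists C, forall x, box lo hi x -> `|v x| <= C.
Proof.
move=> cv.
have : compact [set x : 'rV[R]_n | forall i, `[lo 0 i, hi 0 i]%classic (x ord0 i)].
  apply: (rV_compact (A := fun i => `[lo 0 i, hi 0 i]%classic)) => i.
  exact: segment_compact.
move=> /(continuous_compact (continuous_subspaceT cv)) /compact_bounded[C [_ HC]].
exists (C + 1) => x bx; apply: HC; first by rewrite ltrDl.
exists x => // i /=; have := bx i; rewrite in_itv/=.
by case/andP => /ltW -> /ltW ->.
Qed.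

Lemma continuous_bounded_measurable lo hi v :
  continuous v -> bounded_measurable lo hi v.
Proof.
move=> cv; split; last exact: continuous_bounded_box.
by apply: measurable_funTS; exact: continuous_measurable_rV.
Qed.

End measurability.

(** * Square-integrable functions *)

Section L2.
Context (R : realType) (n : nat) (mu : {measure set 'rV[R]_n -> \bar R}).
Context (D : set 'rV[R]_n) (mD : measurable D).
Implicit Types v w : 'rV[R]_n -> R.

Lemma L2norm_ge0 v : (0 <= L2norm mu D v)%E.
Proof. exact: Lnorm_ge0. Qed.

Lemma L2normE v :
  L2norm mu D v = ((\int[mu]_(x in D) (v x ^+ 2)%:E) `^ 2^-1)%E.
Proof.
rewrite /L2norm unlock; congr (_ `^ _)%E; rewrite [RHS]integral_mkcond.
apply: eq_integral => x _ /=; rewrite patchE /patch; case: ifP => _ /=.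
  by rewrite powR_mulrn// real_normK// num_real.
by rewrite normr0 powR0// pnatr_eq0.
Qed.

Lemma integral_sqr_ge0 v : (0 <= \int[mu]_(x in D) (v x ^+ 2)%:E)%E.
Proof. by apply: integral_ge0 => x _; rewrite lee_fin sqr_ge0. Qed.

Lemma measurable_sqr v : measurable_fun D v ->
  measurable_fun D (fun x => (v x ^+ 2)%:E).
Proof. by move=> mv; apply/measurable_EFinP; exact: measurable_funX. Qed.

(** Passes between the norm and the integrability of the square, where domination arguments are
    available. *)
Lemma L2norm_lty v : measurable_fun D v ->
  (L2norm mu D v < +oo)%E <-> mu.-integrable D (fun x => (v x ^+ 2)%:E).
Proof.
move=> mv; rewrite L2normE; split=> [v2|/integrableP[_ v2]].
  apply/integrableP; split; first exact: measurable_sqr.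
  under eq_integral => x _ do rewrite gee0_abs ?lee_fin ?sqr_ge0//.
  move: v2; case: (integral _ _ _) (integral_sqr_ge0 v) => [r _ _|_|//].
    exact: ltry.
  by rewrite poweRyr.
apply: poweR_lty; move: v2.
by under eq_integral => x _ do rewrite gee0_abs ?lee_fin ?sqr_ge0//.
Qed.

Lemma L2norm0 : L2norm mu D (fun=> 0) = 0%E.
Proof.
rewrite L2normE integral0_eq ?poweR0r ?invr_neq0 ?pnatr_eq0// => x _.
by rewrite expr0n.
Qed.

Lemma ae_eq_L2norm v w : measurable_fun D v -> measurable_fun D w ->
  {ae mu, forall x, D x -> v x = w x} -> L2norm mu D v = L2norm mu D w.
Proof.
move=> mv mw vw; rewrite !L2normE; congr (_ `^ _)%E.
apply: ae_eq_integral => //; [exact: measurable_sqr..|].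
by apply: filterS vw => x vw /vw ->.
Qed.

Lemma ler_L2normD v w : measurable_fun D v -> measurable_fun D w ->
  (L2norm mu D (fun x => (v x + w x)%R) <= L2norm mu D v + L2norm mu D w)%E.
Proof.
move=> mv mw; rewrite {1}/L2norm.
have -> : (fun x => v x + w x) \_ D = (v \_ D \+ w \_ D).
  by apply/funext => x; rewrite /= !patchE; case: ifP => _ /=; rewrite ?addr0.
apply: minkowski_EFin; [exact/(measurable_restrictT _ mD)..|].
by rewrite ler1n.
Qed.

Lemma integralM_le_L2norm v w : measurable_fun D v -> measurable_fun D w ->
  (\int[mu]_(x in D) `|v x * w x|%:E <= L2norm mu D v * L2norm mu D w)%E.
Proof.
move=> mv mw.
apply: le_trans (hoelder mu (f := v \_ D) (g := w \_ D) (p := 2) (q := 2) _ _ _ _ _).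
- rewrite Lnorm1 [leLHS]integral_mkcond le_eqVlt; apply/orP; left; apply/eqP.
  apply: eq_integral => x _; rewrite /= /patch.
  by case: ifP => _ //=; rewrite mulr0 normr0.
- exact/(measurable_restrictT _ mD).
- exact/(measurable_restrictT _ mD).
- by [].
- by [].
- by lra.
Qed.

Lemma measurable_lincomb (c : R) v w : measurable_fun D v -> measurable_fun D w ->
  measurable_fun D (fun x => c * v x + w x).
Proof. by move=> mv mw; apply: measurable_funD => //; exact: measurable_funM. Qed.

Lemma L2norm_lincomb_lty (c : R) v w : measurable_fun D v -> measurable_fun D w ->
  (L2norm mu D v < +oo)%E -> (L2norm mu D w < +oo)%E ->
  (L2norm mu D (fun x => (c * v x + w x)%R) < +oo)%E.
Proof.
move=> mv mw /L2norm_lty-/(_ mv) iv /L2norm_lty-/(_ mw) iw.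
apply/L2norm_lty; first exact: measurable_lincomb.
(* Pointwise domination [(c v + w)^2 <= 2 c^2 v^2 + 2 w^2]. *)
have i2 : mu.-integrable D
    (fun x => (2 * c ^+ 2)%:E * (v x ^+ 2)%:E + 2%:E * (w x ^+ 2)%:E)%E.
  by apply: integrableD => //; apply: integrableZl.
apply: le_integrable i2 => //.
  by apply: (@measurable_sqr (fun x => c * v x + w x)); exact: measurable_lincomb.
move=> x _; rewrite -!EFinM -EFinD lee_fin !ger0_norm ?sqr_ge0//; last first.
  by have := sqr_ge0 (c * v x); have := sqr_ge0 (w x); nra.
have := sqr_ge0 (c * v x - w x); nra.
Qed.

Lemma L2_integrable v : (mu D < +oo)%E -> measurable_fun D v ->
  (L2norm mu D v < +oo)%E -> mu.-integrable D (EFin \o v).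
Proof.
move=> muD mv /L2norm_lty-/(_ mv) iv.
(* [|v|] is dominated by [1 + v^2], and the constant is integrable since [D] has finite measure. *)
have i2 : mu.-integrable D (fun x => (cst 1%:E x + (v x ^+ 2)%:E)%E).
  apply: integrableD => //; apply/integrableP; split=> //.
  under eq_integral => x _ do rewrite /= normr1.
  by rewrite integral_cst// mul1e.
apply: le_integrable i2 => //; first exact/measurable_EFinP.
move=> x _; rewrite /= lee_fin [leRHS]ger0_norm ?addr_ge0 ?sqr_ge0//.
by rewrite -(real_normK (num_real (v x))); have := sqr_ge0 (`|v x| - 1); nra.
Qed.

End L2.

(** * Weak derivatives on a box *)

Section sobolev_theory.
Context (R : realType) (n : nat) (lo hi : 'rV[R]_n).
Implicit Types (v w b phi : 'rV[R]_n -> R) (G H : 'rV[R]_n -> 'rV[R]_n).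

Let Omega := box lo hi.
Let lam := @lebesgue R n.
Let mOmega : measurable Omega := measurable_box lo hi.
Let lamOmega : (lam Omega < +oo)%E := lebesgue_box_lty lo hi.
#[local] Hint Resolve mOmega lamOmega : core.

Lemma bounded_measurableD b1 b2 : bounded_measurable lo hi b1 ->
  bounded_measurable lo hi b2 -> bounded_measurable lo hi (fun x => b1 x + b2 x).
Proof.
move=> [m1 [C1 b1C]] [m2 [C2 b2C]]; split; first exact: measurable_funD.
exists (C1 + C2) => x Ox; apply: le_trans (ler_normD _ _) _.
by rewrite lerD ?b1C ?b2C.
Qed.

Lemma bounded_measurableM b1 b2 : bounded_measurable lo hi b1 ->
  bounded_measurable lo hi b2 -> bounded_measurable lo hi (fun x => b1 x * b2 x).
Proof.
move=> [m1 [C1 b1C]] [m2 [C2 b2C]]; split; first exact: measurable_funM.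
exists (C1 * C2) => x Ox; rewrite normrM.
by rewrite ler_pM ?b1C ?b2C.
Qed.

Lemma bounded_measurable_sum (I : Type) (s : seq I) (b : I -> 'rV[R]_n -> R) :
  (forall i, bounded_measurable lo hi (b i)) ->
  bounded_measurable lo hi (fun x => \sum_(i <- s) b i x).
Proof.
move=> mb; elim: s => [|i s [IHm [C IHC]]].
  split; last by exists 0 => x _; rewrite big_nil normr0.
  by under eq_fun do rewrite big_nil; exact: measurable_cst.
under eq_fun do rewrite big_cons.
by apply: bounded_measurableD => //; split=> //; exists C.
Qed.

Lemma eq_bounded_measurable b1 b2 : {in Omega, b1 =1 b2} ->
  bounded_measurable lo hi b1 -> bounded_measurable lo hi b2.
Proof.
move=> b12 [m1 [C b1C]]; split; first exact: eq_measurable_fun m1.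
by exists C => x Ox; rewrite -b12 ?inE//; exact: b1C.
Qed.

Lemma test_function_bounded phi : test_function lo hi phi ->
  bounded_measurable lo hi phi.
Proof. by case=> /(_ [::])[+ _] _; exact: continuous_bounded_measurable. Qed.

Lemma test_function_partial phi i : test_function lo hi phi ->
  (forall x, derivable phi x (delta_mx 0 i : 'rV[R]_n)) /\
  bounded_measurable lo hi (partial i phi).
Proof.
case=> sphi _; split=> [x|]; first exact: (sphi [::]).2.
by have [+ _] := sphi [:: i]; exact: continuous_bounded_measurable.
Qed.

Lemma partial0 i : partial i (fun _ : 'rV[R]_n => 0) = (fun=> 0).
Proof. by apply/funext => x; rewrite /partial (derive_cst (0 : R)). Qed.

(** This test function makes the supremum in the dual norm nonnegative. *)
Lemma test_function0 : test_function lo hi (fun=> 0).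
Proof.
split; last by exists set0; split=> //; exact: compact0.
move=> s; have -> : iter_partial s (fun=> 0 : R) = (fun=> 0).
  by elim: s => //= i s ->; rewrite partial0.
by split=> [|i x]; [exact: cst_continuous|exact: derivable_cst].
Qed.

Lemma measurable_in_L2 v : in_L2 lo hi v -> measurable_fun Omega v.
Proof. by case. Qed.

Lemma in_L2_lincomb (c : R) v w : in_L2 lo hi v -> in_L2 lo hi w ->
  in_L2 lo hi (fun x => c * v x + w x).
Proof.
move=> [mv v2] [mw w2]; split; first exact: measurable_lincomb.
exact: L2norm_lincomb_lty.
Qed.

(** Supplies the integrability that linearity of the real-valued integral demands: the box has
    finite measure, and a bounded factor does no harm. *)
Lemma integrable_L2_bounded v b : in_L2 lo hi v -> bounded_measurable lo hi b ->
  lam.-integrable Omega (EFin \o (fun x => v x * b x)).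
Proof.
move=> [mv v2] [mb [C bC]].
have iv : lam.-integrable Omega (EFin \o v) by exact: L2_integrable.
apply: (eq_integrable mOmega _ _ _ (integrableMl mOmega iv mb _)) => //.
exists C; split; first exact: num_real.
by move=> M CM x Ox; apply: le_trans (bC _ Ox) _; exact: ltW.
Qed.

Lemma Rintegral_lincomb (c : R) (f1 f2 : 'rV[R]_n -> R) :
  lam.-integrable Omega (EFin \o f1) -> lam.-integrable Omega (EFin \o f2) ->
  \int[lam]_(x in Omega) (c * f1 x + f2 x) =
  c * \int[lam]_(x in Omega) f1 x + \int[lam]_(x in Omega) f2 x.
Proof.
move=> i1 i2; rewrite -RintegralZl// -RintegralD//.
apply: (eq_integrable mOmega _ _ _ (integrableZl mOmega c i1)) => //.
Qed.

Lemma ae_eq_Rintegral (f1 f2 : 'rV[R]_n -> R) :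
  measurable_fun Omega f1 -> measurable_fun Omega f2 ->
  {ae lam, forall x, Omega x -> f1 x = f2 x} ->
  \int[lam]_(x in Omega) f1 x = \int[lam]_(x in Omega) f2 x.
Proof.
move=> m1 m2 f12; congr fine; apply: ae_eq_integral => //; try exact/measurable_EFinP.
by apply: filterS f12 => x f12 /f12 ->.
Qed.

Lemma weak_grad_lincomb (c : R) v w G H :
  weak_grad lo hi v G -> weak_grad lo hi w H ->
  weak_grad lo hi (fun x => c * v x + w x) (fun x => c *: G x + H x).
Proof.
move=> [v2 vG] [w2 wH]; split; first exact: in_L2_lincomb.
move=> i; have [G2 vGi] := vG i; have [H2 wHi] := wH i.
under [X in in_L2 _ _ X]eq_fun do rewrite !mxE.
under [X in weak_partial _ _ _ _ X]eq_fun do rewrite !mxE.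
split; first exact: in_L2_lincomb.
move=> phi tphi; have bphi := test_function_bounded tphi.
have [_ bdphi] := test_function_partial i tphi.
under eq_Rintegral => x _ do rewrite mulrDl -mulrA.
under [in RHS]eq_Rintegral => x _ do rewrite mulrDl -mulrA.
rewrite !Rintegral_lincomb; try exact: integrable_L2_bounded.
by rewrite vGi// wHi// mulrN opprD.
Qed.

(** The same gradient serves both functions, since norms and integrals against test functions ignore
    null sets. Measurability of [v] is asked for separately because almost everywhere equality does
    not provide it. *)
Lemma ae_eq_weak_grad v w G : measurable_fun Omega v ->
  {ae lam, forall x, Omega x -> v x = w x} ->
  weak_grad lo hi w G -> weak_grad lo hi v G.
Proof.
move=> mv vw [[mw w2] wG]; split.
  by split=> //; rewrite (ae_eq_L2norm mOmega mv mw vw).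
move=> i; have [G2 wGi] := wG i; split=> // phi tphi.
have [_ [mdphi _]] := test_function_partial i tphi.
rewrite -wGi//; apply: ae_eq_Rintegral; try exact: measurable_funM.
by apply: filterS vw => x vw /vw ->.
Qed.

Lemma weak_grad0 : weak_grad lo hi (fun=> 0) (fun=> 0).
Proof.
have i0 : in_L2 lo hi (fun=> 0).
  by split; [exact: measurable_cst|rewrite L2norm0// ltry].
split=> // i; under [X in in_L2 _ _ X]eq_fun do rewrite mxE.
under [X in weak_partial _ _ _ _ X]eq_fun do rewrite mxE.
split=> // phi _.
under eq_Rintegral do rewrite mul0r.
under [in RHS]eq_Rintegral do rewrite mul0r.
by rewrite Rintegral_cst// mul0r oppr0.
Qed.

Lemma H1norm_eq0 v G : L2norm lam Omega v = 0%E ->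
  (forall i, L2norm lam Omega (fun x => G x 0 i) = 0%E) -> H1norm lo hi v G = 0%E.
Proof.
move=> v0 G0; rewrite /H1norm v0 expe2 mule0 add0e big1 ?poweR0r//.
by move=> i _; rewrite G0 expe2 mule0.
Qed.

(** Serves the block of the empty set, whose error is identically zero. The zero gradient and the
    zero Hessian are admissible in the infimum. *)
Lemma H2norm0 : (H2norm lo hi (fun=> 0%R) <= 0)%E.
Proof.
apply: ereal_inf_lbound; exists (fun=> 0%R), (fun=> 0%R).
have [i0 _] := weak_grad0.
split; first exact: weak_grad0.
- move=> i j; have [_ /(_ j)] := weak_grad0.
  under [X in in_L2 _ _ X]eq_fun do rewrite mxE.
  under [X in weak_partial _ _ _ _ X]eq_fun do rewrite mxE.
  move=> [_ w0].
  under [X in in_L2 _ _ X]eq_fun do rewrite mxE.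
  under [X in weak_partial _ _ _ X _]eq_fun do rewrite mxE.
  by under [X in weak_partial _ _ _ _ X]eq_fun do rewrite mxE.
- rewrite L2norm0// expe2 mule0 add0e big1 ?add0e => [|i _]; last first.
    by under [X in L2norm _ _ X]eq_fun do rewrite mxE; rewrite L2norm0// expe2 mule0.
  rewrite big1 ?poweR0r// => i _; rewrite big1// => j _.
  by under [X in L2norm _ _ X]eq_fun do rewrite mxE; rewrite L2norm0// expe2 mule0.
Qed.

(** * The weak operator and its dual norm *)

Section residual.
Context (L : diffop R n) (hL : regular_coefficients lo hi L).

(** The factor of the [i]-th gradient component in the integrand of [weak_op]. Isolating it makes
    the linearity of [weak_op] in the pair of a function and its gradient visible. *)
Let flux phi i x : R :=
  \sum_j partial j (fun y => op_a L y i j * phi y) x + op_b L x 0 i * phi x.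

(** By the product rule inside the box, the derivative of coefficient times test function is a sum
    of products of bounded functions; this is where bounded derivatives of the leading coefficients
    enter. *)
Lemma flux_bounded phi i : test_function lo hi phi ->
  bounded_measurable lo hi (flux phi i).
Proof.
move=> tphi; have bphi := test_function_bounded tphi.
case: hL => a0 a1 b0 _; apply: bounded_measurableD; last exact: bounded_measurableM.
apply: bounded_measurable_sum => j.
have [dphi bdphi] := test_function_partial j tphi.
have [da bda] := a1 i j j.
apply: (eq_bounded_measurable (b1 := fun x =>
  op_a L x i j * partial j phi x + phi x * partial j (fun y => op_a L y i j) x)).
  move=> x /set_mem Ox; rewrite [RHS](deriveM (da x Ox) (dphi x)).
  by [].
by apply: bounded_measurableD; exact: bounded_measurableM.
Qed.

Lemma weak_opE v G phi : weak_op lo hi L v G phi =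
  \int[lam]_(x in Omega) (\sum_i G x 0 i * flux phi i x + v x * (op_kappa L x * phi x)).
Proof.
apply: eq_Rintegral => x _; congr (_ + _); last by rewrite mulrCA mulrA.
rewrite /dotp mulr_suml -big_split/=; apply: eq_bigr => i _.
by rewrite mulrDr mulr_sumr; congr (_ + _); rewrite mulrCA mulrA.
Qed.

Lemma weak_op_integrable v G phi : weak_grad lo hi v G -> test_function lo hi phi ->
  lam.-integrable Omega
   (EFin \o (fun x => \sum_i G x 0 i * flux phi i x + v x * (op_kappa L x * phi x))).
Proof.
move=> [v2 vG] tphi.
have iG : lam.-integrable Omega (fun x => \sum_i (G x 0 i * flux phi i x)%:E)%E.
  apply: integrable_sum => // i _; apply: integrable_L2_bounded.
    exact: (vG i).1.
  exact: flux_bounded.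
have iv : lam.-integrable Omega (EFin \o (fun x => v x * (op_kappa L x * phi x))).
  apply: integrable_L2_bounded => //; apply: bounded_measurableM.
    by case: hL.
  exact: test_function_bounded.
apply: (eq_integrable mOmega _ _ _ (integrableD mOmega iG iv)) => x _ /=.
by rewrite EFinD sumEFin.
Qed.

Lemma weak_op_lincomb (c : R) v w G H phi : test_function lo hi phi ->
  weak_grad lo hi v G -> weak_grad lo hi w H ->
  weak_op lo hi L (fun x => c * v x + w x) (fun x => c *: G x + H x) phi =
  c * weak_op lo hi L v G phi + weak_op lo hi L w H phi.
Proof.
move=> tphi vG wH; rewrite !weak_opE -Rintegral_lincomb; try exact: weak_op_integrable.
apply: eq_Rintegral => x _.
rewrite [X in _ = X + _]mulrDr [RHS]addrACA [X in _ + X = _]mulrDl -[X in _ + (X + _) = _]mulrA.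
congr (_ + _); rewrite mulr_sumr -big_split.
by apply: eq_bigr => i _; rewrite !mxE [LHS]mulrDl -[X in X + _]mulrA.
Qed.

Lemma ae_eq_weak_op v w G phi : test_function lo hi phi -> measurable_fun Omega v ->
  {ae lam, forall x, Omega x -> v x = w x} -> weak_grad lo hi w G ->
  weak_op lo hi L v G phi = weak_op lo hi L w G phi.
Proof.
move=> tphi mv vw wG; have vG := ae_eq_weak_grad mv vw wG.
rewrite !weak_opE; apply: ae_eq_Rintegral.
- exact/measurable_EFinP/measurable_int/weak_op_integrable.
- exact/measurable_EFinP/measurable_int/weak_op_integrable.
- by apply: filterS vw => x vw /vw ->.
Qed.

Lemma Hm1norm_op_ge0 v : (0 <= Hm1norm_op lo hi L v)%E.
Proof.
apply: le_ereal_inf_tmp => _ [G _ ->]; apply: ereal_sup_ubound.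
exists (fun=> 0); last first.
  rewrite /weak_op; under eq_Rintegral => x _.
    rewrite big1 => [|i _]; last first.
      rewrite big1// => j _; under [X in partial _ X]eq_fun do rewrite mulr0.
      by rewrite partial0 mulr0.
    rewrite !mulr0 !addr0.
    over.
  by rewrite Rintegral_cst// mul0r normr0.
split; first exact: test_function0.
rewrite H1norm_eq0 ?lee_fin ?ler01// ?L2norm0// => i.
under [X in L2norm _ _ X]eq_fun do rewrite mxE partial0.
exact: L2norm0.
Qed.

(** Without a weak gradient the infimum runs over the empty set and equals [+oo]. *)
Lemma Hm1norm_op_lty v : (Hm1norm_op lo hi L v < +oo)%E -> in_H1 lo hi v.
Proof.
move=> Lv; apply: contrapT => nv; move: Lv.
suff -> : Hm1norm_op lo hi L v = +oo%E by rewrite ltxx.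
rewrite /Hm1norm_op (_ : mkset _ = set0) ?ereal_inf0//.
by apply/seteqP; split=> // t [G vG _]; apply: nv; exists G.
Qed.

Let Hm1norm_set v : set (\bar R) :=
  [set t | exists2 G, weak_grad lo hi v G &
    t = ereal_sup [set `|weak_op lo hi L v G phi|%:E | phi in
          [set phi | test_function lo hi phi /\
                     (H1norm lo hi phi (grad phi) <= 1)%E]]].

Lemma Hm1norm_op_lincomb (c : R) v w :
  (Hm1norm_op lo hi L v < +oo)%E -> (Hm1norm_op lo hi L w < +oo)%E ->
  (Hm1norm_op lo hi L (fun x => c * v x + w x)%R <=
   `|c|%:E * Hm1norm_op lo hi L v + Hm1norm_op lo hi L w)%E.
Proof.
move=> Lv Lw.
have : (0 <= Hm1norm_op lo hi L v)%E by exact: Hm1norm_op_ge0.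
have : (0 <= Hm1norm_op lo hi L w)%E by exact: Hm1norm_op_ge0.
case VE : (Hm1norm_op lo hi L v) Lv => [V| |]//= _.
case WE : (Hm1norm_op lo hi L w) Lw => [W| |]//= _ W0 V0.
apply/lee_addgt0Pr => eps eps0.
have c1 : 0 < `|c| + 1 by rewrite ltr_wpDl.
(* Near-minimizers within [d] for both functions cost [|c| d + d = eps] in total; the [+ 1] also
   keeps the denominator positive when [c = 0]. *)
pose d := eps / (`|c| + 1).
have d0 : 0 < d by rewrite divr_gt0.
have [sv [G vG svE] Gv] : exists2 sv, Hm1norm_set v sv & (sv < (V + d)%:E)%E.
  by apply: ereal_inf_lt; rewrite -/(Hm1norm_op lo hi L v) VE lte_fin ltrDl.
have [sw [H wH swE] Hw] : exists2 sw, Hm1norm_set w sw & (sw < (W + d)%:E)%E.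
  by apply: ereal_inf_lt; rewrite -/(Hm1norm_op lo hi L w) WE lte_fin ltrDl.
have epsE : (`|c|%:E * V%:E + W%:E + eps%:E)%E = (`|c| * (V + d) + (W + d))%:E.
  rewrite -EFinM -!EFinD; congr EFin.
  have -> : eps = d * (`|c| + 1) by rewrite /d divfK// gt_eqF.
  by ring.
rewrite {}epsE; apply: ge_ereal_inf.
exists (ereal_sup [set `|weak_op lo hi L (fun x => c * v x + w x)
    (fun x => c *: G x + H x) phi|%:E | phi in
  [set phi | test_function lo hi phi /\ (H1norm lo hi phi (grad phi) <= 1)%E]]).
  by exists (fun x => c *: G x + H x) => //; exact: weak_grad_lincomb.
apply: ge_ereal_sup => _ [phi [tphi phi1] <-].
rewrite weak_op_lincomb// lee_fin; apply: le_trans (ler_normD _ _) _.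
rewrite normrM; apply: lerD; [apply: ler_wpM2l => //|]; rewrite -lee_fin.
  by apply: le_trans (ltW Gv); rewrite svE; apply: ereal_sup_ubound; exists phi.
by apply: le_trans (ltW Hw); rewrite swE; apply: ereal_sup_ubound; exists phi.
Qed.

(** Every gradient competing for [w] competes for [v] with the same dual value. *)
Lemma ae_le_Hm1norm_op v w : measurable_fun Omega v ->
  {ae lam, forall x, Omega x -> v x = w x} ->
  (Hm1norm_op lo hi L v <= Hm1norm_op lo hi L w)%E.
Proof.
move=> mv vw; apply: le_ereal_inf_tmp => _ [G wG ->].
apply: ereal_inf_lbound; exists G; first exact: ae_eq_weak_grad wG.
congr ereal_sup; apply/seteqP; split=> _ [phi [tphi phi1] <-]; exists phi => //;
  by rewrite (ae_eq_weak_op tphi mv vw wG).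
Qed.

(** * Traces and null sets *)

Section trace.
Context (Tr : ('rV[R]_n -> R) -> ('rV[R]_n -> R)) (hTr : trace_operator lo hi Tr).

Lemma boundary_ae_and (P Q : 'rV[R]_n -> Prop) :
  boundary_ae lo hi P -> boundary_ae lo hi Q ->
  boundary_ae lo hi (fun x => P x /\ Q x).
Proof.
move=> hP hQ i up; have := hP i up; have := hQ i up.
apply: filterS2 => y Qy Py yf; split; [exact: Py|exact: Qy].
Qed.

Lemma boundary_ae_sub (P Q : 'rV[R]_n -> Prop) : (forall x, P x -> Q x) ->
  boundary_ae lo hi P -> boundary_ae lo hi Q.
Proof. by move=> PQ hP i up; apply: filterS (hP i up) => y Py /Py; exact: PQ. Qed.

(** A vanishing sum of nonnegative integrals over the faces makes each of them vanish, and then each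
    integrand vanishes almost everywhere. *)
Lemma boundary_L2norm_eq0 t : boundary_measurable lo hi t ->
  (boundary_L2norm lo hi t <= 0)%E -> boundary_ae lo hi (fun x => t x = 0).
Proof.
move=> mt t0 i up.
have mf : measurable (face lo hi i) by exact: measurable_box.
have ige0 i' up' : (0 <= \int[lebesgue R n.-1]_(y in face lo hi i')
    (t (face_point lo hi i' up' y) ^+ 2)%:E)%E.
  by apply: integral_ge0 => y _; rewrite lee_fin sqr_ge0.
have sum0 : (\sum_(i < n) \sum_(up : bool) \int[lebesgue R n.-1]_(y in face lo hi i)
    (t (face_point lo hi i up y) ^+ 2)%:E = 0)%E.
  apply: (@poweR_eq0_eq0 _ _ 2^-1); first by apply: sume_ge0 => i' _; exact: sume_ge0.
  by apply/eqP; rewrite eq_le t0 poweR_ge0.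
move/eqP: sum0; rewrite seq_psume_eq0 => [|i' _]; last exact: sume_ge0.
move=> /allP/(_ i (mem_index_enum i))/=.
rewrite seq_psume_eq0// => /allP/(_ up (mem_index_enum up))/= /eqP int0.
have mt2 : measurable_fun (face lo hi i)
    (fun y => (t (face_point lo hi i up y) ^+ 2)%:E).
  by apply/measurable_EFinP; apply: measurable_funX; exact: mt.
have : (\int[lebesgue R n.-1]_(y in face lo hi i)
    `|(t (face_point lo hi i up y) ^+ 2)%:E| = 0)%E.
  by rewrite -int0; apply: eq_integral => y _; rewrite gee0_abs// lee_fin sqr_ge0.
move/(ae_eq_integral_abs _ mf mt2); apply: filterS => y ty /ty /eqP.
by rewrite eqe sqrf_eq0 => /eqP.
Qed.

Lemma ae_eq_trace v w : in_H1 lo hi v -> in_H1 lo hi w ->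
  {ae lam, forall x, Omega x -> v x = w x} ->
  boundary_ae lo hi (fun x => Tr v x = Tr w x).
Proof.
move=> vH wH vw; have [mTr Trlin [C TrC] _] := hTr.
(* The difference [v - w], in the shape [c * w + v] of the linearity clause of [trace_operator]. *)
pose z x := - 1 * w x + v x.
have [G vG] := vH; have [H wG] := wH.
have mz : measurable_fun Omega z.
  by apply: measurable_lincomb; apply: measurable_in_L2; [case: wG|case: vG].
have z0 : {ae lam, forall x, Omega x -> z x = 0}.
  by apply: filterS vw => x vw /vw; rewrite /z mulN1r => ->; rewrite addNr.
have zG := ae_eq_weak_grad mz z0 weak_grad0.
have Hz : H1norm lo hi z (fun=> 0) = 0%E.
  apply: H1norm_eq0 => [|i].
    by rewrite (ae_eq_L2norm mOmega mz (measurable_cst (0 : R)) z0) L2norm0.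
  by under [X in L2norm _ _ X]eq_fun do rewrite mxE; exact: L2norm0.
have Trz : boundary_ae lo hi (fun x => Tr z x = 0).
  apply: boundary_L2norm_eq0; first by apply: mTr; exists (fun=> 0).
  by have := TrC _ _ zG; rewrite Hz mule0.
apply: boundary_ae_sub (boundary_ae_and Trz (Trlin (-1) _ _ wH vH)) => x [].
by rewrite /z => ->; lra.
Qed.

(** * Seminorm properties of the residual norm *)

Section residual_norm.
Context (omega : R) (omega0 : 0 < omega) (N : ('rV[R]_n -> R) -> \bar R).
Context (hN : boundary_norm lo hi N).

Let normR := residual_norm lo hi L omega Tr N.

Lemma residual_norm_ge0 v : (0 <= normR v)%E.
Proof.
have [N0 _ _ _ _] := hN.
by rewrite adde_ge0 ?Hm1norm_op_ge0// mule_ge0// lee_fin ltW.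
Qed.

Lemma residual_norm_lty v : (normR v < +oo)%E ->
  [/\ (Hm1norm_op lo hi L v < +oo)%E, (N (Tr v) < +oo)%E & in_H1 lo hi v].
Proof.
have [N0 _ _ _ _] := hN.
have O0 : (0 <= omega%:E * N (Tr v))%E by rewrite mule_ge0// lee_fin ltW.
move=> vy; have Lv : (Hm1norm_op lo hi L v < +oo)%E.
  by apply: le_lt_trans vy; rewrite leeDl.
have : (omega%:E * N (Tr v) < +oo)%E.
  by apply: le_lt_trans vy; rewrite leeDr// Hm1norm_op_ge0.
split=> //; last exact: Hm1norm_op_lty.
(* Strict positivity of [omega] excludes the product [0 * +oo], so an infinite trace norm would be
   seen. *)
by rewrite ltey; apply: contraTneq H => ->; rewrite gt0_muley// ?ltxx ?lte_fin.
Qed.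

(** Finiteness places both functions in H^1, where the trace is linear, makes the homogeneity of [N]
    available and allows the terms to be regrouped as real numbers. *)
Lemma residual_norm_lincomb (c : R) v w : (normR v < +oo)%E -> (normR w < +oo)%E ->
  (normR (fun x => c * v x + w x)%R <= `|c|%:E * normR v + normR w)%E.
Proof.
move=> /residual_norm_lty[Lv Nv vH] /residual_norm_lty[Lw Nw wH].
have [N0 _ NZ ND Nae] := hN; have [_ Trlin _ _] := hTr.
have -> : (`|c|%:E * normR v + normR w =
    (`|c|%:E * Hm1norm_op lo hi L v + Hm1norm_op lo hi L w) +
    omega%:E * (`|c|%:E * N (Tr v) + N (Tr w)))%E.
  rewrite /normR /residual_norm; set a := Hm1norm_op _ _ _ v in Lv *.
  set b := Hm1norm_op _ _ _ w in Lw *.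
  have : (0 <= a)%E by exact: Hm1norm_op_ge0.
  have : (0 <= b)%E by exact: Hm1norm_op_ge0.
  have := N0 (Tr v); have := N0 (Tr w).
  case: (N _) Nv => [nv| |]// _; case: (N _) Nw => [nw| |]// _.
  case: a Lv => [a| |]// _; case: b Lw => [b| |]// _ _ _ _ _.
  by rewrite -!(EFinM, EFinD); congr EFin; ring.
rewrite /normR /residual_norm; apply: leeD; first exact: Hm1norm_op_lincomb.
rewrite lee_pmul2l ?lte_fin//.
rewrite (Nae _ _ (Trlin c _ _ vH wH)).
by apply: le_trans (ND (fun x => c * Tr v x) _) _; rewrite NZ.
Qed.

Lemma ler_residual_normD v w : (normR v < +oo)%E -> (normR w < +oo)%E ->
  (normR (fun x => v x + w x)%R <= normR v + normR w)%E.
Proof.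
move=> vy wy; have := residual_norm_lincomb 1 vy wy.
by rewrite normr1 mul1e; under [X in normR X]eq_fun do rewrite mul1r.
Qed.

Lemma residual_norm0 : normR (fun=> 0) = 0%E.
Proof.
have [_ N0 _ _ _] := hN; have [_ Trlin _ _] := hTr.
have H0 : in_H1 lo hi (fun=> 0) by exists (fun=> 0); exact: weak_grad0.
rewrite /normR /residual_norm (_ : N _ = 0%E) ?mule0 ?adde0.
  apply/eqP; rewrite eq_le Hm1norm_op_ge0 andbT.
  suff : exists2 t, Hm1norm_set (fun=> 0) t & (t <= 0)%E by exact: ge_ereal_inf.
  eexists; first by exists (fun=> 0); [exact: weak_grad0|reflexivity].
  apply/ereal_supP => _ [phi _ <-]; rewrite weak_opE.
  under eq_Rintegral => x _.
    rewrite mul0r addr0 big1 => [|i _]; last by rewrite mxE mul0r.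
    over.
  by rewrite Rintegral_cst// mul0r normr0.
(* Linearity with [c = -1] and both arguments zero reads [Tr 0 = - Tr 0 + Tr 0] almost
   everywhere. *)
apply/N0; have := Trlin (-1) _ _ H0 H0.
under [X in Tr X]eq_fun do rewrite mulr0 addr0.
move=> Tr0 i up; apply: filterS (Tr0 i up) => y Try /Try ->.
by rewrite mulN1r addNr.
Qed.

Lemma ler_residual_normN v : (normR v < +oo)%E ->
  (normR (fun x => - v x)%R <= normR v)%E.
Proof.
move=> vy; have := @residual_norm_lincomb (-1) v (fun=> 0) vy.
rewrite residual_norm0 ltry normrN1 mul1e adde0 => /(_ isT).
by under [X in normR X]eq_fun do rewrite mulN1r addr0.
Qed.

Lemma ae_le_residual_norm v w : measurable_fun Omega v -> (normR w < +oo)%E ->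
  {ae lam, forall x, Omega x -> v x = w x} -> (normR v <= normR w)%E.
Proof.
move=> mv wy vw; have [Lw Nw wH] := residual_norm_lty wy.
have [G wG] := wH; have vH : in_H1 lo hi v.
  by exists G; exact: ae_eq_weak_grad wG.
have [_ _ _ _ Nae] := hN.
rewrite /normR /residual_norm (Nae _ _ (ae_eq_trace vH wH vw)).
by apply: leeD => //; exact: ae_le_Hm1norm_op.
Qed.

End residual_norm.
End trace.
End residual.
End sobolev_theory.

(** * Perturbation of gradient covariance matrices *)

Section gradient_covariance.
Context (R : realType) (n : nat) (mu : {measure set 'rV[R]_n -> \bar R}).
Context (D : set 'rV[R]_n) (mD : measurable D).
Implicit Types (v w : 'rV[R]_n -> R) (F G : 'rV[R]_n -> 'rV[R]_n).

Lemma ler_L2norm v w : measurable_fun D v -> measurable_fun D w ->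
  (forall x, D x -> `|v x| <= w x) -> (L2norm mu D v <= L2norm mu D w)%E.
Proof.
move=> mv mw vw; rewrite !L2normE.
apply: gt0_ler_poweR; rewrite ?invr_ge0 ?ler0n ?in_itv/= ?leey ?integral_sqr_ge0//.
apply: ge0_le_integral => //; try exact: measurable_sqr.
- by move=> x _; rewrite lee_fin sqr_ge0.
- move=> x Dx; rewrite lee_fin -(real_normK (num_real (v x))).
  by rewrite ler_pXn2r ?nnegrE ?(le_trans _ (vw x Dx))// vw.
Qed.

Lemma measurable_enorm F : (forall i, measurable_fun D (fun x => F x 0 i)) ->
  measurable_fun D (fun x => enorm (F x)).
Proof.
move=> mF; apply: (measurableT_comp (f := @Num.sqrt R)).
  by apply: continuous_measurable_fun; exact: sqrt_continuous.
by apply: measurable_sum => i; exact: measurable_funM.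
Qed.

Lemma measurable_sub_coord F G i :
  measurable_fun D (fun x => F x 0 i) -> measurable_fun D (fun x => G x 0 i) ->
  measurable_fun D (fun x => (F x - G x) 0 i).
Proof.
by move=> mF mG; under eq_fun do rewrite !mxE; exact: measurable_funB.
Qed.

Lemma coord_le_enorm (x : 'rV[R]_n) i : `|x 0 i| <= enorm x.
Proof.
rewrite -(@ler_pXn2r _ 2)// ?nnegrE ?enorm_ge0// sqr_enorm real_normK ?num_real//.
by rewrite /dotp (bigD1 i)//= -expr2 lerDl sumr_ge0// => j _; rewrite -expr2 sqr_ge0.
Qed.

Lemma dotp_grad_cov F (x y : 'rV[R]_n) :
  (forall i, measurable_fun D (fun z => F z 0 i)) -> (vL2norm mu D F < +oo)%E ->
  mu.-integrable D (EFin \o (fun z => dotp x (F z) * dotp y (F z))) /\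
  dotp (x *m (grad_cov mu D F)^T) y =
  \int[mu]_(z in D) (dotp x (F z) * dotp y (F z)).
Proof.
move=> mF /L2norm_lty-/(_ (measurable_enorm mF)) F2.
have iF i j : mu.-integrable D (EFin \o (fun z => F z 0 i * F z 0 j)).
  apply: le_integrable F2 => //.
    by apply/measurable_EFinP; exact: measurable_funM.
  move=> z _; rewrite /= lee_fin normrM [leRHS]ger0_norm ?sqr_ge0// expr2.
  by rewrite ler_pM ?coord_le_enorm.
(* The double sum is flattened to a list of index pairs; integrability and linearity are carried
   through one induction because each step of the second uses the first. *)
have iS (c : 'I_n -> 'I_n -> R) (s : seq ('I_n * 'I_n)) :
    mu.-integrable D (EFin \o (fun z => \sum_(p <- s) c p.1 p.2 * (F z 0 p.1 * F z 0 p.2))) /\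
    \int[mu]_(z in D) (\sum_(p <- s) c p.1 p.2 * (F z 0 p.1 * F z 0 p.2)) =
    \sum_(p <- s) c p.1 p.2 * \int[mu]_(z in D) (F z 0 p.1 * F z 0 p.2).
  have iZ p : mu.-integrable D (EFin \o (fun z => c p.1 p.2 * (F z 0 p.1 * F z 0 p.2))).
    exact: (eq_integrable mD _ _ _ (integrableZl mD (c p.1 p.2) (iF p.1 p.2))).
  elim: s => [|p s [IHi IHe]].
    rewrite big_nil; split.
      apply: (eq_integrable mD (cst 0%E)) => [z _|]; first by rewrite /= big_nil.
      exact: integrable0.
    by under eq_Rintegral do rewrite big_nil; rewrite Rintegral_cst// mul0r.
  split.
    apply: (eq_integrable mD _ _ _ (integrableD mD (iZ p) IHi)) => z _.
    by rewrite /= big_cons.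
  under eq_Rintegral do rewrite big_cons.
  by rewrite RintegralD// IHe RintegralZl// big_cons.
have E z : dotp x (F z) * dotp y (F z) =
    \sum_(p <- [seq (i, j) | i <- index_enum 'I_n, j <- index_enum 'I_n])
      x 0 p.1 * y 0 p.2 * (F z 0 p.1 * F z 0 p.2).
  rewrite big_allpairs /dotp mulr_suml; apply: eq_bigr => i _.
  by rewrite mulr_sumr; apply: eq_bigr => j _ /=; ring.
have [I1 I2] := iS (fun i j => x 0 i * y 0 j)
  [seq (i, j) | i <- index_enum 'I_n, j <- index_enum 'I_n].
split; first by apply: (eq_integrable mD _ _ _ I1) => z _ /=; rewrite E.
under eq_Rintegral do rewrite E.
rewrite I2 big_allpairs /= /dotp exchange_big/=; apply: eq_bigr => j _.
rewrite mxE mulr_suml; apply: eq_bigr => i _.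
rewrite !mxE; under eq_Rintegral do rewrite mulrC.
by ring.
Qed.

(** The difference of the two rank-one forms telescopes into terms linear in [G - F]; integrating
    and applying Hoelder with exponents 2 and 2 gives the product of norms. Only [G] is assumed
    square integrable. *)
Lemma opnorm_grad_covB F G :
  (forall i, measurable_fun D (fun z => F z 0 i)) ->
  (forall i, measurable_fun D (fun z => G z 0 i)) -> (vL2norm mu D G < +oo)%E ->
  ((opnorm (grad_cov mu D F - grad_cov mu D G))%:E <=
   (vL2norm mu D G + vL2norm mu D F) * vL2norm mu D (fun x => G x - F x)%R)%E.
Proof.
move=> mF mG G2.
have mGF i : measurable_fun D (fun z => (G z - F z) 0 i) by exact: measurable_sub_coord.
have nF := measurable_enorm mF; have nG := measurable_enorm mG.
have nGF := measurable_enorm mGF.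
have G0 : (0 <= vL2norm mu D G)%E by exact: L2norm_ge0.
have F0 : (0 <= vL2norm mu D F)%E by exact: L2norm_ge0.
have GF0 : (0 <= vL2norm mu D (fun x => G x - F x)%R)%E by exact: L2norm_ge0.
have tri : (vL2norm mu D F <= vL2norm mu D G + vL2norm mu D (fun x => G x - F x)%R)%E.
  apply: le_trans (ler_L2normD mu mD nG nGF); apply: ler_L2norm => //.
    exact: measurable_funD.
  move=> z _; rewrite ger0_norm ?enorm_ge0// -{1}(subKr (G z) (F z)).
  by apply: le_trans (ler_enormD _ _) _; rewrite enormN.
(* If [F] has infinite norm then so has [G - F], and the right-hand side is [+oo]. *)
have [Foo|Foo] := eqVneq (vL2norm mu D F) +oo%E.
  have GFoo : vL2norm mu D (fun x => G x - F x)%R = +oo%E.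
    move: tri G2; rewrite Foo; case: (vL2norm mu D G) => // g.
    by case: (vL2norm _ _ _).
  rewrite Foo GFoo addey ?gt_eqF// ?(lt_le_trans _ G0)//.
  by rewrite mulyy leey.
have F2 : (vL2norm mu D F < +oo)%E by rewrite ltey.
have GF2 : (vL2norm mu D (fun x => G x - F x)%R < +oo)%E.
  apply: le_lt_trans (lte_add_pinfty G2 F2).
  apply: le_trans (ler_L2normD mu mD nG nF); apply: ler_L2norm => //.
    exact: measurable_funD.
  move=> z _; rewrite ger0_norm ?enorm_ge0//.
  by apply: le_trans (ler_enormD _ _) _; rewrite enormN.
pose g z := (enorm (G z) + enorm (F z)) * enorm (G z - F z).
have mg : measurable_fun D g by apply: measurable_funM => //; exact: measurable_funD.
have g0 z : 0 <= g z by rewrite mulr_ge0 ?addr_ge0 ?enorm_ge0.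
have gK : (\int[mu]_(z in D) (g z)%:E <=
    (vL2norm mu D G + vL2norm mu D F) * vL2norm mu D (fun x => G x - F x)%R)%E.
  under eq_integral => z _.
    rewrite -(ger0_norm (g0 z)); over.
  apply: le_trans (integralM_le_L2norm mu mD _ nGF) _; first exact: measurable_funD.
  by rewrite lee_wpmul2r// ler_L2normD.
have gi : mu.-integrable D (EFin \o g).
  apply/integrableP; split; first exact/measurable_EFinP.
  under eq_integral => z _ do rewrite /= ger0_norm//.
  by apply: le_lt_trans gK _; rewrite lte_mul_pinfty ?adde_ge0// ge0_fin_numE ?adde_ge0//
    lte_add_pinfty.
have gE : (\int[mu]_(z in D) (g z)%:E)%E = (\int[mu]_(z in D) g z)%:E.
  by rewrite /Rintegral fineK// integrable_fin_num.
rewrite gE in gK; apply: le_trans gK; rewrite lee_fin.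
apply: opnorm_bilinear => [|x y]; first by apply: Rintegral_ge0 => z _; exact: g0.
rewrite linearB/= mulmxBr dotpBl.
have [iF ->] := dotp_grad_cov x y mF F2.
have [iG ->] := dotp_grad_cov x y mG G2.
rewrite -RintegralB// -mulrA mulrC -RintegralZl//.
apply: le_Rintegral => //.
- exact: (eq_integrable mD _ _ _ (integrableB mD iF iG)).
- exact: (eq_integrable mD _ _ _ (integrableZl mD _ gi)).
move=> z _.
(* The mixed product of [F] in the direction [x] and [G] in the direction [y] is inserted and
   removed. *)
have -> : dotp x (F z) * dotp y (F z) - dotp x (G z) * dotp y (G z) =
    - (dotp x (F z) * dotp y (G z - F z)) - dotp x (G z - F z) * dotp y (G z).
  by rewrite !dotpBr; ring.
have H (a b c e : 'rV[R]_n) : `|dotp a b * dotp c e| <= enorm a * enorm c * (enorm b * enorm e).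
  by rewrite mulrACA normrM ler_pM// cauchy_schwarz.
have := H x (F z) y (G z - F z); rewrite ler_norml => /andP[H1 _].
have := H x (G z - F z) y (G z); rewrite ler_norml => /andP[H2 _].
rewrite /g; nra.
Qed.

End gradient_covariance.

(** * Regularity of the random feature functions *)

Section features.
Context (R : realType).

(** A partial derivative is the pointwise limit of difference quotients along the steps
    [1 / (m + 1)], each of them measurable. *)
Lemma measurable_partial n (v : 'rV[R]_n -> R) i : measurable_fun setT v ->
  (forall x, derivable v x (delta_mx 0 i : 'rV[R]_n)) ->
  measurable_fun setT (partial i v).
Proof.
move=> mv dv; pose e := delta_mx 0 i : 'rV[R]_n.
pose q m x := (m.+1%:R^-1)^-1 *: (v (m.+1%:R^-1 *: e + x) - v x) : R.
apply: (@measurable_fun_cvg _ _ _ _ q) => [m|x _].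
  apply: measurable_funM => //; apply: measurable_funB => //.
  apply: (measurableT_comp mv); apply/measurable_fun_rVP => j.
  under eq_fun do rewrite !mxE.
  by apply: measurable_funD => //; exact: measurable_rV_coord.
have := dv x; rewrite /derivable -/e => /(@cvg_comp _ _ _ (fun m => m.+1%:R^-1) _ \oo); apply.
(* The steps tend to [0] without ever being [0], as the punctured neighbourhood filter requires. *)
move=> U; rewrite /dnbhs/= => -[r /= r0 rU].
near=> m; apply: rU; last by rewrite /= invr_neq0.
rewrite /ball_/= sub0r normrN ger0_norm ?invr_ge0//.
by near: m; exact: (near_infty_natSinv_lt (PosNum r0)).
Unshelve. all: by end_near. Qed.

Lemma derivable_bigsum n (I : Type) (s : seq I) (P : pred I) (f : I -> 'rV[R]_n -> R) x e :
  (forall i, derivable (f i) x e) -> derivable (fun y => \sum_(i <- s | P i) f i y) x e.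
Proof.
move=> df; elim: s => [|i s IH].
  by under eq_fun do rewrite big_nil; exact: derivable_cst.
under eq_fun do rewrite big_cons.
by case: (P i) => //; exact: (derivableD (df i) IH).
Qed.

Context (sigma : R -> R) (hsigma : C2 sigma).

Lemma continuous_activation : continuous sigma.
Proof.
move=> t; apply: differentiable_continuous; apply/derivable1_diffP.
by case: hsigma.
Qed.

Lemma derivable_affine (a b t : R) : derivable (fun h : R => sigma (h * a + b)) t 1.
Proof.
apply/derivable1_diffP; apply: (differentiable_comp (f := fun h : R => h * a + b)).
  apply/derivable1_diffP; apply: derivableD; last exact: derivable_cst.
  by apply: derivableM; [exact: derivable_id|exact: derivable_cst].
by apply/derivable1_diffP; case: hsigma.
Qed.

Lemma measurable_dotp n (a : 'rV[R]_n) : measurable_fun setT (dotp a).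
Proof.
by apply: measurable_sum => i; apply: measurable_funM => //; exact: measurable_rV_coord.
Qed.

Lemma measurable_activation n (a : 'rV[R]_n) (b : R) :
  measurable_fun setT (fun x => sigma (dotp a x + b)).
Proof.
apply: (measurableT_comp (f := sigma)).
  by apply: continuous_measurable_fun; exact: continuous_activation.
by apply: measurable_funD => //; exact: measurable_dotp.
Qed.

Lemma measurable_block_fun d M (p : coord_params R d) (S : {set 'I_d})
    (c : 'rV[R]_(nfeat M S)) : measurable_fun setT (block_fun sigma p c).
Proof.
apply: measurable_sum => m; apply: measurable_funM => //.
by case: (S == _) => //; exact: measurable_activation.
Qed.

Lemma measurable_restr d (S : {set 'I_d}) : measurable_fun setT (@restr R d S).
Proof.
apply/measurable_fun_rVP => i; under eq_fun do rewrite mxE.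
exact: measurable_rV_coord.
Qed.

Lemma measurable_coord_fun d M (A : {set {set 'I_d}}) (p : coord_params R d)
    (c : forall S : {set 'I_d}, 'rV[R]_(nfeat M S)) :
  measurable_fun setT (coord_fun sigma A p c).
Proof.
rewrite /coord_fun; under eq_fun do rewrite -big_enum/=.
apply: measurable_sum => S.
apply: (measurableT_comp (f := block_fun sigma p (c S)) (g := @restr R d S)).
  exact: measurable_block_fun.
exact: measurable_restr.
Qed.

Lemma measurable_glob_fun d r Mglob (W : 'M[R]_(d, r)) (q : glob_params R r)
    (c : 'rV[R]_Mglob) : measurable_fun setT (glob_fun sigma W q c).
Proof.
apply: measurable_sum => m; apply: measurable_funM => //.
exact: measurable_activation.
Qed.

Lemma measurable_joint_fun d r M Mglob (A : {set {set 'I_d}}) (p : coord_params R d)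
    (W : 'M[R]_(d, r)) (q : glob_params R r) (c : coefs R d M Mglob) :
  measurable_fun setT (joint_fun sigma A p W q c).
Proof.
by apply: measurable_funD; [exact: measurable_coord_fun|exact: measurable_glob_fun].
Qed.

Lemma derivable_coord_fun d M (A : {set {set 'I_d}}) (p : coord_params R d)
    (c : forall S : {set 'I_d}, 'rV[R]_(nfeat M S)) (x e : 'rV[R]_d) :
  derivable (coord_fun sigma A p c) x e.
Proof.
apply: derivable_bigsum => S; apply: derivable_bigsum => m.
apply: (derivableM (f := cst (c S 0 m))); first exact: derivable_cst.
case: (S == _); first exact: derivable_cst.
apply/derivable1P.
(* Along the line through [x] in the direction [e], a feature is the activation of an affine
   function of the parameter. *)
rewrite (_ : (fun h : R => _) = (fun h : R => sigma (h * dotp (cp_omega p S m) (restr S e) +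
  (dotp (cp_omega p S m) (restr S x) + cp_b p S m)))); first exact: derivable_affine.
apply/funext => h; congr sigma; rewrite addrA; congr (_ + _).
rewrite /dotp mulr_sumr -big_split/=; apply: eq_bigr => k _.
by rewrite !mxE; ring.
Qed.

Lemma measurable_grad_coord_fun d M (A : {set {set 'I_d}}) (p : coord_params R d)
    (c : forall S : {set 'I_d}, 'rV[R]_(nfeat M S)) i :
  measurable_fun setT (fun x => grad (coord_fun sigma A p c) x 0 i).
Proof.
under eq_fun do rewrite mxE.
apply: measurable_partial => [|x]; first exact: measurable_coord_fun.
exact: derivable_coord_fun.
Qed.

End features.

(** * Union bounds over inner measurable events *)

Section with_probability_theory.
Context d (T : measurableType d) (R : realType) (P : probability T R).
Implicit Types (E F : set T) (p q : R).

Lemma with_probability_sub p q E F : q <= p -> E `<=` F ->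
  with_probability P p E -> with_probability P q F.
Proof.
move=> qp EF [E' [mE' E'E pE']]; exists E'; split=> //; first exact: subset_trans EF.
by apply: le_trans pE'; rewrite lee_fin.
Qed.

Lemma with_probabilityT : with_probability P 1 setT.
Proof. by exists setT; split=> //; rewrite probability_setT. Qed.

(** Inclusion-exclusion for the inner events, whose union has probability at most one. *)
Lemma with_probabilityI p q E F : with_probability P p E -> with_probability P q F ->
  with_probability P (p + q - 1) (E `&` F).
Proof.
move=> [E' [mE' E'E pE']] [F' [mF' F'F qF']]; exists (E' `&` F'); split.
- exact: measurableI.
- by move=> w [E'w F'w]; split; [exact: E'E|exact: F'F].
have fin C : measurable C -> P C \is a fin_num by exact: fin_num_measure.
have PU : (P (E' `|` F') <= 1)%E by apply: probability_le1; exact: measurableU.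
have PUE : (P (E' `|` F') = P E' + P F' - P (E' `&` F'))%E.
  by apply: measureUfinl => //; rewrite ltey_eq fin.
move: PUE; have mU := measurableU _ _ mE' mF'; have mI := measurableI _ _ mE' mF'.
case: (P E') (fin _ mE') pE' => [a| |]// _; rewrite lee_fin => pa.
case: (P F') (fin _ mF') qF' => [b| |]// _; rewrite lee_fin => qb.
case: (P (E' `|` F')) (fin _ mU) PU => [c| |]// _; rewrite lee_fin => c1.
case: (P (E' `&` F')) (fin _ mI) => [e| |]// _ [cE].
by rewrite lee_fin; lra.
Qed.

Lemma with_probability_all (I : eqType) (s : seq I) (eta : I -> R) (E : I -> set T) :
  (forall i, i \in s -> with_probability P (1 - eta i) (E i)) ->
  with_probability P (1 - \sum_(i <- s) eta i) [set w | forall i, i \in s -> E i w].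
Proof.
elim: s => [_|i s IH sE].
  by apply: with_probability_sub with_probabilityT => //; rewrite big_nil subr0.
have {}IH := IH (fun j js => sE j (mem_behead (s := i :: s) js)).
apply: with_probability_sub (with_probabilityI (sE i (mem_head _ _)) IH).
  by rewrite big_cons; lra.
by move=> w [Ei Es] j; rewrite inE => /predU1P[->//|]; exact: Es.
Qed.

End with_probability_theory.

(** * Blocks sorted by cardinality and the failure budget *)

Section blocks.
Context (d : nat) (A : {set {set 'I_d}}).

(** A nonempty member of [A] has cardinality between [1] and [Kmax A], hence is counted at exactly
    one level. *)
Lemma sum_by_card (V : nmodType) (F : {set 'I_d} -> V) :
  \sum_(S in A | S != finset.set0) F S =
  \sum_(1 <= k < (Kmax A).+1) \sum_(S in A | #|S| == k) F S.
Proof.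
rewrite (exchange_big_dep (mem A))/= => [|k S _ /andP[]//].
rewrite big_mkcondr/=; apply: eq_bigr => S SA; rewrite SA/=.
under eq_bigl do rewrite eq_sym.
rewrite big_nat1_eq card_gt0 ltnS /Kmax.
by rewrite (leq_bigmax_cond (F := fun S : {set 'I_d} => #|S|) S SA) andbT.
Qed.

Lemma Kmax_gt0 S : S \in A -> S != finset.set0 -> (0 < Kmax A)%N.
Proof.
move=> SA S0; apply: (@leq_trans #|S|); first by rewrite card_gt0.
exact: (leq_bigmax_cond (F := fun S : {set 'I_d} => #|S|) S SA).
Qed.

Lemma nblk_gt0 S : S \in A -> (0 < nblk A #|S|)%N.
Proof. by move=> SA; apply/card_gt0P; exists S; rewrite inE SA eqxx. Qed.

(** Each inhabited level spends [eta / Kmax A] in total, and there are [Kmax A] levels. Uninhabited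
    levels spend nothing, hence an inequality. *)
Lemma sum_block_budget (R : realType) (eta : R) : 0 <= eta ->
  \sum_(S in A | S != finset.set0) eta / ((Kmax A)%:R * (nblk A #|S|)%:R) <= eta.
Proof.
move=> eta0; rewrite sum_by_card.
apply: (@le_trans _ _ (\sum_(1 <= k < (Kmax A).+1) eta / (Kmax A)%:R)).
  apply: ler_sum => k _.
  rewrite (eq_bigr (fun=> eta / ((Kmax A)%:R * (nblk A k)%:R))); last first.
    by move=> S /andP[_ /eqP ->].
  rewrite sumr_const (_ : #|_| = nblk A k); last first.
    by rewrite /nblk; apply: eq_card => S; rewrite !inE.
  have [->|n0] := eqVneq (nblk A k) 0%N; first by rewrite mulr0n divr_ge0.
  by rewrite -[leLHS]mulr_natr invfM mulrA divfK ?pnatr_eq0.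
rewrite sumr_const_nat subSS subn0 -[leLHS]mulr_natr.
have [->|K0] := eqVneq (Kmax A) 0%N; first by rewrite mulr0.
by rewrite divfK// pnatr_eq0.
Qed.

End blocks.

(** * Deterministic error bound for the fitted function *)

Section error_bound.
Context (R : realType) (n : nat) (lo hi : 'rV[R]_n).
Context (L : diffop R n) (hL : regular_coefficients lo hi L).
Context (Tr : ('rV[R]_n -> R) -> ('rV[R]_n -> R)) (hTr : trace_operator lo hi Tr).
Context (omega : R) (omega0 : 0 < omega) (N : ('rV[R]_n -> R) -> \bar R).
Context (hN : boundary_norm lo hi N).

Let Omega := box lo hi.
Let normL2 := L2norm (lebesgue R n) Omega.
Let normR := residual_norm lo hi L omega Tr N.
Let mOmega : measurable Omega := measurable_box lo hi.

Lemma residual_norm_le_fin v (a : R) : (normR v <= a%:E)%E ->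
  exists2 b, normR v = b%:E & 0 <= b <= a.
Proof.
have := residual_norm_ge0 L Tr omega0 hN v; rewrite -/normR.
by case: (normR v) => [b| |]// b0 ba; exists b => //; rewrite -!lee_fin b0 ba.
Qed.

Lemma residual_normD_le v w (a b : R) : (normR v <= a%:E)%E -> (normR w <= b%:E)%E ->
  (normR (fun x => v x + w x)%R <= (a + b)%:E)%E.
Proof.
move=> va wb; rewrite EFinD; apply: le_trans (leeD va wb).
apply: ler_residual_normD => //; first exact: (le_lt_trans va (ltry _)).
exact: (le_lt_trans wb (ltry _)).
Qed.

Lemma residual_normN_le v (a : R) : (normR v <= a%:E)%E ->
  (normR (fun x => - v x)%R <= a%:E)%E.
Proof.
move=> va; apply: (le_trans _ va); apply: ler_residual_normN => //.
exact: (le_lt_trans va (ltry _)).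
Qed.

Lemma measurable_residual v (a : R) : (normR v <= a%:E)%E -> measurable_fun Omega v.
Proof.
move=> va; have vy := le_lt_trans va (ltry _).
by have [_ _ [G [[]]]] := residual_norm_lty omega0 hN vy.
Qed.

(** In the application [zs] is the coordinate feature error, [dr] the rotation error, [vr] the
    global feature error, and [k] collects the sampling and regularization terms. *)
Lemma fit_error_bound (C_ell C_ls tau a b c k : R)
    (u ud uh uperp zs dr vr : 'rV[R]_n -> R) :
  0 < C_ell -> 0 < C_ls -> 0 <= k ->
  measurable_fun Omega u -> measurable_fun Omega ud -> measurable_fun Omega uh ->
  (normL2 u < +oo)%E ->
  (forall v, in_H1 lo hi v -> (N (Tr v) < +oo)%E -> (normL2 v <= C_ell%:E * normR v)%E) ->
  {ae lebesgue R n, forall x, Omega x -> u x - ud x = zs x + dr x + vr x + uperp x} ->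
  (normL2 uperp + C_ell%:E * normR uperp <= tau%:E * normL2 u)%E ->
  (normR zs <= a%:E)%E -> (normR dr <= b%:E)%E -> (normR vr <= c%:E)%E ->
  (normR (fun x => uh x - ud x)%R <=
   C_ls%:E * (normR (fun x => ud x - u x)%R + k%:E))%E ->
  (normL2 (fun x => u x - uh x)%R <= (Num.max 1 C_ls * tau)%:E * normL2 u +
    (C_ell * (1 + C_ls) * (a + b + c + k))%R%:E)%E.
Proof.
move=> Cell0 Cls0 k0 mu_ mud muh u2 stab dec uperp_le za db vc ls.
have /fineK uE : normL2 u \is a fin_num by rewrite ge0_fin_numE ?L2norm_ge0.
move: uperp_le; rewrite -uE -EFinM; set U := fine _ => uperp_le.
have R0 := residual_norm_ge0 L Tr omega0 hN uperp; rewrite -/normR in R0.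
have P0 : (0 <= normL2 uperp)%E by exact: L2norm_ge0.
(* Since [C_ell] is positive, an infinite residual norm would contradict the finite right-hand side
   of [uperp_le]. *)
have [PR PRE] : exists PR, normR uperp = PR%:E.
  move: uperp_le R0 P0; case: (normR uperp) => [r| |]//; first by exists r.
  by rewrite gt0_muley ?lte_fin//; case: (normL2 uperp).
have [P2 P2E] : exists P2, normL2 uperp = P2%:E.
  move: uperp_le P0; rewrite PRE -EFinM.
  by case: (normL2 uperp) => [r| |]//; exists r.
move: uperp_le R0 P0; rewrite PRE P2E -EFinM -EFinD !lee_fin => uperp_le PR0 P20.
have PRle : (normR uperp <= PR%:E)%E by rewrite PRE.
have e1 := residual_normD_le (residual_normD_le za db) vc.
have w1 := residual_normD_le e1 PRle.
have dw : (normR (fun x => ud x - u x)%R <= (a + b + c + PR)%:E)%E.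
  apply: le_trans (residual_normN_le w1).
  apply: ae_le_residual_norm => //; first exact: measurable_funB.
    exact: le_lt_trans (residual_normN_le w1) (ltry _).
  by apply: filterS dec => x dec /dec <-; rewrite opprB.
have fit : (normR (fun x => uh x - ud x)%R <= (C_ls * (a + b + c + PR + k))%:E)%E.
  apply: le_trans ls _; rewrite EFinM lee_pmul2l ?lte_fin// EFinD.
  exact: leeD.
have e2 := residual_normD_le e1 (residual_normN_le fit).
have [s sE /andP[s0 sle]] := residual_norm_le_fin e2.
have mperp := measurable_residual PRle.
have me2 := measurable_residual e2.
have -> : normL2 (fun x => u x - uh x) =
    normL2 (fun x => uperp x + (zs x + dr x + vr x + - (uh x - ud x))).
  apply: ae_eq_L2norm => //; [exact: measurable_funB|exact: measurable_funD|].
  by apply: filterS dec => x dec Ox; move: (dec Ox); lra.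
apply: le_trans (ler_L2normD _ mOmega mperp me2) _.
have [_ Ny H1] := residual_norm_lty omega0 hN (le_lt_trans e2 (ltry _)).
apply: (@le_trans _ _ (P2%:E + C_ell%:E * s%:E)%E).
  by rewrite -sE; apply: leeD; [rewrite -P2E|exact: stab].
rewrite -!(EFinM, EFinD) lee_fin.
(* [uperp] enters twice, directly through its L2 norm and with factor [C_ls] through the
   least-squares estimate. The maximum dominates both weights, so the combined bound on [uperp]
   applies once. *)
have m1 : P2 + C_ls * (C_ell * PR) <= Num.max 1 C_ls * (tau * U).
  apply: le_trans (_ : _ <= Num.max 1 C_ls * (P2 + C_ell * PR)) _; last first.
    by rewrite ler_wpM2l// le_max ler01.
  rewrite mulrDr; apply: lerD.
    by rewrite ler_peMl// le_max lexx.
  by rewrite ler_wpM2r ?mulr_ge0 ?(ltW Cell0)// le_max lexx orbT.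
have m2 : C_ell * s <= C_ell * (a + b + c + C_ls * (a + b + c + PR + k)).
  by rewrite ler_pM2l.
(* The argument yields [k] with the factor [C_ell * C_ls] only; adding this term gives the uniform
   factor [C_ell * (1 + C_ls)]. *)
have m3 : 0 <= C_ell * k by rewrite mulr_ge0// ltW.
rewrite -mulrA.
by move: m1 m2 m3; set M := Num.max _ _; nra.
Qed.

End error_bound.

(** * Aggregation of the block errors and assembly of the theorem *)

Lemma H2norm_ge0 (R : realType) n (lo hi : 'rV[R]_n) v : (0 <= H2norm lo hi v)%E.
Proof. by apply: le_ereal_inf_tmp => _ [G [H [_ _ ->]]]; exact: poweR_ge0. Qed.

(** The empty block drops out because [f] vanishes there; the others are compared termwise and
    sorted by cardinality. *)
Lemma block_errors_le (R : realType) d (A : {set {set 'I_d}})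
    (f : {set 'I_d} -> \bar R) (g : {set 'I_d} -> R) : f finset.set0 = 0%E ->
  (forall S, S \in A -> S != finset.set0 -> (0 <= f S <= (g S)%:E)%E) ->
  ((\sum_(S in A) f S ^+ 2) `^ 2^-1 <=
   (Num.sqrt (\sum_(1 <= k < (Kmax A).+1) \sum_(S in A | #|S| == k) g S ^+ 2))%:E)%E.
Proof.
move=> f0 fg.
have f2 S : S \in A -> S != finset.set0 -> (0 <= f S ^+ 2 <= (g S ^+ 2)%:E)%E.
  move=> SA S0; have /andP[fS0 fSg] := fg S SA S0.
  by rewrite expe2 mule_ge0//= EFin_expe expe2 lee_pmul.
have f20 : (f finset.set0 ^+ 2 = 0)%E by rewrite f0 expe2 mule0.
rewrite -powR12_sqrt; last first.
  by apply: sumr_ge0 => k _; apply: sumr_ge0 => S _; exact: sqr_ge0.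
rewrite -poweR_EFin; apply: gt0_ler_poweR; rewrite ?invr_ge0 ?ler0n ?in_itv/= ?leey ?andbT//.
- apply: sume_ge0 => S SA; rewrite -expe2.
  have [->|S0] := eqVneq S finset.set0; first by rewrite f20.
  by have /andP[] := f2 S SA S0.
- rewrite lee_fin; apply: sumr_ge0 => k _; apply: sumr_ge0 => S _; exact: sqr_ge0.
rewrite -sum_by_card -sumEFin [leLHS]big_mkcond [leRHS]big_mkcond/=.
apply: lee_sum => S _; case: ifPn => SA //=; rewrite -expe2.
have [->|S0] /= := eqVneq S finset.set0; rewrite -?expe2; first by rewrite f20.
by have /andP[] := f2 S SA S0.
Qed.

Theorem theorem4p10
  (R : realType) (d : nat)
  (* domain and reference measure *)
  (lo hi : 'rV[R]_d) (hbox : forall i, lo 0 i < hi 0 i)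
  (mu1 : 'I_d -> probability (measurableTypeR R) R)
  (hmu1 : forall i, mu1 i [set t | lo 0 i < t < hi 0 i] = 1%E)
  (* operator, trace, residual norm *)
  (L : diffop R d) (hLreg : regular_coefficients lo hi L)
  (hLell : uniformly_elliptic lo hi L)
  (Tr : ('rV[R]_d -> R) -> ('rV[R]_d -> R)) (hTr : trace_operator lo hi Tr)
  (Ynorm : ('rV[R]_d -> R) -> \bar R) (hY : boundary_norm lo hi Ynorm)
  (omega_th : R) (homega_th : 0 < omega_th)
  (* the solution *)
  (f g u : 'rV[R]_d -> R) (Du : 'rV[R]_d -> 'rV[R]_d)
  (hDu : weak_grad lo hi u Du) (hu : weak_solution lo hi L f u Du)
  (hug : boundary_ae lo hi (fun x => Tr u x = g x))
  (* sample space *)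
  (dT : measure_display) (T : measurableType dT) (P : probability T R)
  (* coordinate trial space *)
  (A : {set {set 'I_d}}) (hA0 : finset.set0 \in A)
  (hA1 : forall i : 'I_d, finset.set1 i \in A)
  (sigma : R -> R) (hsigma : C2 sigma)
  (M : nat -> nat) (R_rf : R) (hR_rf : 0 < R_rf)
  (p : T -> coord_params R d) (hp : measurable_coord_params p)
  (* collocation points *)
  (Nint Nbc : nat) (hNint : (0 < Nint)%N) (hNbc : (0 < Nbc)%N)
  (xint : 'I_Nint -> T -> 'rV[R]_d) (xbc : 'I_Nbc -> T -> 'rV[R]_d)
  (hxint : forall n, measurable_fun [set: T] (xint n) /\
                     forall w, box lo hi (xint n w))
  (hxbc : forall n, measurable_fun [set: T] (xbc n) /\
                    forall w, (cbox lo hi `\` box lo hi) (xbc n w))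
  (* first-stage predictor and active subspace *)
  (ct : T -> forall S : {set 'I_d}, 'rV[R]_(nfeat M S))
  (hct : forall S, measurable_fun [set: T] (fun w => ct w S))
  (N_AS : nat) (hN_AS : (0 < N_AS)%N)
  (xAS : 'I_N_AS -> T -> 'rV[R]_d)
  (hxAS : forall n, measurable_fun [set: T] (xAS n)) :
  let Omega := box lo hi in
  let mu := product_prob mu1 in
  let normL2 := L2norm (lebesgue R d) Omega in
  let normR := residual_norm lo hi L omega_th Tr Ynorm in
  let ut := fun w => coord_fun sigma A (p w) (ct w) in
  let Dut := fun w => grad (ut w) in
  iid_indep P mu (generating_events ut xint xbc) xAS ->
  (vL2norm mu Omega Du < +oo)%E ->
  let Cu := grad_cov mu Omega Du in
  let Ct := fun w => grad_cov mu Omega (Dut w) in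
  let Ch := fun w => empirical_cov (Dut w) (fun n => xAS n w) in
  forall (r : nat) (hr0 : (0 < r)%N) (hrd : (r < d)%N)
    (nu : 'rV[R]_d) (hnu : exists U, eigenbasis Cu U nu)
    (W : 'M[R]_(d, r)) (hW : leading_basis (ltnW hrd) Cu W)
    (Wh : T -> 'M[R]_(d, r))
    (hWh : forall w, leading_basis (ltnW hrd) (Ch w) (Wh w))
    (Theta : T -> 'rV[R]_r)
    (hTheta : forall w, principal_angles (Wh w) W (Theta w))
    (* global trial space *)
    (Mglob : nat) (hMglob : (0 < Mglob)%N)
    (q : T -> glob_params R r) (hq : measurable_glob_params q)
    (* constants *)
    (C_ridge C_ell C_op C_ls C_samp C_reg : R)
    (hC_ridge : 0 < C_ridge) (hC_ell : 0 < C_ell) (hC_op : 0 < C_op)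
    (hC_ls : 0 < C_ls) (hC_samp : 0 < C_samp) (hC_reg : 0 < C_reg)
    (L_h a_AS s_rf chi tau_mix B_coef Gamma : R)
    (hL_h : 0 <= L_h) (ha_AS : 0 < a_AS) (hs_rf : 0 < s_rf)
    (hchi : 0 <= chi) (htau : 0 <= tau_mix) (hGamma : 1 <= Gamma)
    (E_trunc : R -> ('rV[R]_r -> R) -> R)
    (hE_trunc : forall rho h, 0 <= E_trunc rho h)
    (ell_AS : R -> R)
    (hell_AS : forall eta, 0 < eta < 1 -> 0 < ell_AS eta)
    (e : {set 'I_d} -> nat -> R -> R -> R)
    (he : forall S m rho eta, 0 <= e S m rho eta)
    (* joint collocation least-squares fit *)
    (omega_bc lambda_reg : R)
    (homega_bc : 0 < omega_bc) (hlambda : 0 <= lambda_reg)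
    (ch : T -> coefs R d M Mglob)
    (hch : forall w c,
       let loss := collocation_loss sigma A L f g omega_bc lambda_reg
         (fun n => xint n w) (fun n => xbc n w) (p w) (Wh w) (q w) in
       loss (ch w) <= loss c)
    (eta_feat eta_ASfeat eta_LS eta_AS : R)
    (h_eta_feat : 0 < eta_feat < 1) (h_eta_ASfeat : 0 < eta_ASfeat < 1)
    (h_eta_LS : 0 < eta_LS < 1) (h_eta_AS : 0 < eta_AS < 1)
    (h_eta : eta_feat + eta_ASfeat + eta_LS + eta_AS < 1)
    (* components of the decomposition, rotation, comparison coefficients *)
    (uS : forall S : {set 'I_d}, 'rV[R]_#|S| -> R)
    (h : 'rV[R]_r -> R) (uperp : 'rV[R]_d -> R)
    (Q : T -> 'M[R]_r) (cd : T -> coefs R d M Mglob),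
  let uh := fun w => joint_fun sigma A (p w) (Wh w) (q w) (ch w) in
  let theta := fun w => sin_angles_norm (Theta w) in
  let hridge := fun x : 'rV[R]_d => h (x *m W) in
  let hrot := fun w (x : 'rV[R]_d) => h ((x *m Wh w) *m (Q w)^T) in
  let K := Kmax A in
  let X_Omega := Num.sqrt (\int[mu]_(x in Omega) (enorm x ^+ 2)) in
  let E_AS := a_AS * (E_trunc R_rf h +
    Mglob%:R `^ (- (s_rf / (2 * r%:R))) * ell_AS eta_ASfeat) in
  let Delta := nu 0 (Ordinal (leq_ltn_trans (leq_pred r) hrd))
             - nu 0 (Ordinal hrd) in
  let normH2 := fun S : {set 'I_d} => H2norm (restr S lo) (restr S hi) in
  let blockinf := fun (S : {set 'I_d}) w =>
    ereal_inf [set normH2 S (fun y => uS S y - v y) | v in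
               block_space sigma M (p w) S] in
  let globinf := fun w =>
    ereal_inf [set normR (fun x => hrot w x - v x) | v in
               glob_space sigma Mglob (Wh w) (q w)] in
  let vS := fun (S : {set 'I_d}) w => block_fun sigma (p w) (c_coord (cd w) S) in
  let zS := fun (S : {set 'I_d}) w y => uS S y - vS S w y in
  let vAS := fun w => glob_fun sigma (Wh w) (q w) (c_glob (cd w)) in
  let ud := fun w => joint_fun sigma A (p w) (Wh w) (q w) (cd w) in
  let feat_event := [set w | forall S, S \in A -> S != finset.set0 ->
    (blockinf S w <=
     (e S (M #|S|) R_rf (eta_feat / (K%:R * (nblk A #|S|)%:R)))%:E)%E] in
  let glob_event := [set w | (globinf w <= E_AS%:E)%E] in
  let ls_event := [set w |
    (normR (fun x => uh w x - ud w x)%R <=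
     C_ls%:E * (normR (fun x => ud w x - u x)%R
       + (C_samp * chi + C_reg * Num.sqrt lambda_reg * B_coef)%:E))%E] in
  let AS_event := [set w |
    opnorm (Ch w - Ct w) + opnorm (Ct w - Cu) <= Delta / 2] in
  (* (H1) *)
  {ae lebesgue R d, forall x, Omega x ->
     u x = \sum_(S in A) uS S (restr S x) + hridge x + uperp x} ->
  (normL2 uperp + C_ell%:E * normR uperp <= tau_mix%:E * normL2 u)%E ->
  (* (H2) *)
  (forall v, in_H1 lo hi v -> (Ynorm (Tr v) < +oo)%E ->
     (normL2 v <= C_ell%:E * normR v)%E) ->
  (* (H3) *)
  (forall w, (Q w)^T *m Q w = 1%:M /\
     opnorm (W - Wh w *m (Q w)^T) <= Num.sqrt 2 * theta w) ->
  (forall w, (normR (fun x => hridge x - hrot w x)%R <=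
     (C_ridge * L_h * X_Omega * theta w)%:E)%E) ->
  (* (H4) *)
  (forall S, S \in A -> S != finset.set0 -> forall eta, 0 < eta < 1 ->
     with_probability P (1 - eta)
       [set w | (blockinf S w <= (e S (M #|S|) R_rf eta)%:E)%E]) ->
  (* (H5) *)
  with_probability P (1 - eta_ASfeat) glob_event ->
  (* (H6) *)
  (forall w, vS finset.set0 w = uS finset.set0) ->
  (forall S w, S \in A -> S != finset.set0 ->
     normH2 S (zS S w) = blockinf S w) ->
  (forall w, feat_event w ->
     (normR (fun x => (\sum_(S in A) zS S w (restr S x))%R) <=
      (C_op * Num.sqrt Gamma)%:E *
      (\sum_(S in A) normH2 S (zS S w) ^+ 2) `^ 2^-1)%E) ->
  (* (H7) *)
  (forall w, normR (fun x => hrot w x - vAS w x) = globinf w) ->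
  (forall w, feat_event w -> glob_event w -> coef_norm A (cd w) <= B_coef) ->
  with_probability P (1 - eta_LS)
    [set w | feat_event w -> glob_event w -> ls_event w] ->
  (* (H8) *)
  0 < Delta ->
  with_probability P (1 - eta_AS) AS_event ->
  let C_mix := Num.max 1 C_ls in
  let bound := [set w |
    (normL2 (fun x => u x - uh w x)%R <=
     (C_mix * tau_mix)%:E * normL2 u +
     (C_ell * (1 + C_ls) *
       (C_op * Num.sqrt Gamma *
          Num.sqrt (\sum_(1 <= k < K.+1)
                      block_error M A e R_rf k eta_feat ^+ 2)
        + C_ridge * L_h * X_Omega * theta w + E_AS + C_samp * chi
        + C_reg * Num.sqrt lambda_reg * B_coef))%R%:E)%E] in
  let angle_bound := [set w |
    ((theta w)%:E <= (2 / Delta)%:E *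
       ((opnorm (Ch w - Ct w))%:E +
        (vL2norm mu Omega Du + vL2norm mu Omega (Dut w)) *
        vL2norm mu Omega (fun x => Du x - Dut w x)%R))%E] in
  (feat_event `&` glob_event `&` ls_event `&` AS_event
     `<=` bound `&` angle_bound) /\
  with_probability P (1 - eta_feat - eta_ASfeat - eta_LS - eta_AS)
    (bound `&` angle_bound).
Proof.
move=> Omega mu normL2 normR ut Dut _ Du2 Cu Ct Ch r hr0 hrd nu hnu W hW Wh hWh.
move=> Theta hTheta Mglob _ q _ C_ridge C_ell C_op C_ls C_samp C_reg.
move=> _ C_ell0 C_op0 C_ls0 C_samp0 C_reg0 L_h a_AS s_rf chi tau_mix B_coef Gamma.
move=> _ _ _ chi0 _ _ E_trunc _ ell_AS _ e e0 omega_bc lambda_reg _ _ ch _.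
move=> eta_feat eta_ASfeat eta_LS eta_AS feat01 _ _ _ _ uS h uperp Q cd.
move=> uh theta hridge hrot K X_Omega E_AS Delta normH2 blockinf globinf vS zS vAS ud.
move=> feat_event glob_event ls_event AS_event.
move=> dec uperp_le stab rot h3 h4 h5 vS0 zSE h6 vASE coef_le h7 Delta0 h8.
move=> C_mix bound angle_bound.
have main : feat_event `&` glob_event `&` ls_event `&` AS_event `<=` bound `&` angle_bound.
  move=> w [[[featw globw] lsw] ASw]; split; last first.
    have [U CU] := hnu.
    (* The event controls sampling and fitting errors of the covariance separately; their sum bounds
       the total perturbation required by the angle bound. *)
    have le_sum : opnorm (Ch w - Cu) <= opnorm (Ch w - Ct w) + opnorm (Ct w - Cu).
      by rewrite -{1}(subrKA (Ct w)) ler_opnormD.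
    have th := davis_kahan hr0 (erefl Delta) CU hW (hWh w) (hTheta w) Delta0 (le_trans le_sum ASw).
    have mDu i : measurable_fun Omega (fun x => Du x 0 i).
      by have [_ /(_ i)[[]]] := hDu.
    have mDut i : measurable_fun Omega (fun x => Dut w x 0 i).
      by apply: measurable_funTS; exact: measurable_grad_coord_fun.
    rewrite /angle_bound/=.
    apply: le_trans (_ : _ <= (2 / Delta)%:E * (opnorm (Ch w - Ct w) +
      opnorm (Ct w - Cu))%:E)%E _.
      rewrite -EFinM lee_fin; apply: le_trans th _.
      by rewrite ler_wpM2l// divr_ge0// ltW.
    rewrite lee_pmul2l ?lte_fin ?divr_gt0// EFinD leeD2l//.
    exact: (opnorm_grad_covB (measurable_box lo hi) mDut mDu Du2).
  (* The sign of [B_coef] is not assumed; it follows because on these events [B_coef] dominates a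
     Euclidean norm. *)
  have B0 : 0 <= B_coef by apply: le_trans (coef_le w featw globw); exact: sqrtr_ge0.
  have k0 : 0 <= C_samp * chi + C_reg * Num.sqrt lambda_reg * B_coef.
    by rewrite addr_ge0 ?mulr_ge0 ?sqrtr_ge0// ltW.
  have [u2 _] := hDu; have [mu_ u2y] := u2.
  pose zs x := \sum_(S in A) zS S w (restr S x).
  have zs_le : (normR zs <= (C_op * Num.sqrt Gamma * Num.sqrt
      (\sum_(1 <= k < K.+1) block_error M A e R_rf k eta_feat ^+ 2))%:E)%E.
    apply: le_trans (h6 w featw) _; rewrite [leRHS]EFinM lee_wpmul2l//.
      by rewrite lee_fin mulr_ge0 ?sqrtr_ge0// ltW.
    pose err (S : {set 'I_d}) :=
      e S (M #|S|) R_rf (eta_feat / (K%:R * (nblk A #|S|)%:R)).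
    apply: le_trans (block_errors_le (g := err) _ _) _.
    - apply/eqP; rewrite eq_le H2norm_ge0 andbT /normH2 /zS.
      by under [X in H2norm _ _ X]eq_fun do rewrite vS0 subrr; exact: H2norm0.
    - by move=> S SA S0; rewrite H2norm_ge0 zSE//=; exact: featw.
    rewrite le_eqVlt; apply/orP; left; apply/eqP; congr (Num.sqrt _)%:E.
    apply: eq_bigr => k _; rewrite /block_error sqr_sqrtr; last first.
      by apply: sumr_ge0 => S _; exact: sqr_ge0.
    by apply: eq_bigr => S /andP[_ /eqP Sk]; rewrite /err Sk.
  have vr_le : (normR (fun x => hrot w x - vAS w x)%R <= E_AS%:E)%E.
    by rewrite vASE; exact: globw.
  have [_ dr_le] := conj (rot w) (h3 w).
  have mjoint (c : coefs R d M Mglob) :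
      measurable_fun Omega (joint_fun sigma A (p w) (Wh w) (q w) c).
    by apply: measurable_funTS; exact: measurable_joint_fun.
  have := fit_error_bound hLreg hTr homega_th hY C_ell0 C_ls0 k0 mu_
    (mjoint (cd w)) (mjoint (ch w)) u2y stab _ uperp_le zs_le dr_le vr_le lsw.
  rewrite !addrA; apply; apply: filterS dec => x dec Ox; rewrite (dec Ox).
  rewrite /zs /zS /ud /joint_fun /coord_fun sumrB -/(vAS w) /vS.
  set a := \sum_(S in A) uS _ _; set b := \sum_(S in A) _; ring.
split=> //.
have featP : with_probability P (1 - eta_feat) feat_event.
  have [/ltW feat0 feat1] := andP feat01.
  pose s := [seq S <- enum A | S != finset.set0].
  pose eta (S : {set 'I_d}) := eta_feat / (K%:R * (nblk A #|S|)%:R).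
  apply: with_probability_sub (with_probability_all (s := s) (eta := eta)
    (E := fun S => [set w | (blockinf S w <= (e S (M #|S|) R_rf (eta S))%:E)%E]) _).
  - rewrite lerD2l lerN2 big_filter big_enum_cond.
    exact: sum_block_budget.
  - by move=> w sw S SA S0; apply: sw; rewrite mem_filter S0 mem_enum.
  move=> S; rewrite mem_filter mem_enum => /andP[S0 SA].
  (* A denominator of at least one keeps the share of each block in [(0, 1)], as the feature
     hypothesis demands. *)
  have n0 : (0 < K * nblk A #|S|)%N by rewrite muln_gt0 (Kmax_gt0 SA S0) nblk_gt0.
  apply: h4 => //; rewrite /eta -natrM divr_gt0 ?ltr0n//; last by case/andP: feat01.
  rewrite ltr_pdivrMr ?ltr0n// mul1r; apply: lt_le_trans feat1 _.
  by rewrite ler1n.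
have := with_probabilityI (with_probabilityI (with_probabilityI featP h5) h7) h8.
apply: with_probability_sub; first by lra.
apply: subset_trans main => w [[[fw gw] lw] aw].
(* The least-squares event is only available as an implication from the two feature events, which
   hold here. *)
by split=> //; split=> //; exact: lw.
Qed.
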